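(* In the setting of the context, suppose $\eta^2\left(\frac{3L}{4}-L^2MT^2\eta\right)-\frac{\eta}{2M}<0$. Then for all $t_0\ge0$ and $t\ge1$, $$\begin{aligned} \sum_{k=t_0}^{t_0+t-1}(1+2L^2\eta^2M^2T^3)\|\nabla f(x_k)\|^2\ \ge\ &\frac{\|x_{t_0+t}-x_{t_0}\|^2-3\eta^2\left\|\sum_{m=1}^M\sum_{i=t_0}^{t_0+t-1}\zeta_{i,m}\right\|^2}{3\eta^2M^2t}\\ &-\sum_{k=t_0-2T}^{t_0-1}2L^2M^2\eta^2T^3\|\nabla f(x_k)\|^2\\ &-\sum_{k=t_0}^{t_0+t-1}2L^2\eta^2\left\|\sum_{j=k-\tau_k^{\max}}^{k-1}\sum_{m=1}^M\zeta_{j,m}\right\|^2, \end{aligned}$$ where $0\le\tau_k^{\max}\le T$ are random variables, namely $\tau_k^{\max}$ is a delay among $\tau_{k,1},\dots,\tau_{k,M}$ maximizing $\|x_k-x_{k-\tau_{k,m}}\|$.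
   Context: Setting. $f:\mathbb{R}^d\to\mathbb{R}$, $f(x)=\frac1n\sum_i f_i(x)$ with $f_i$ smooth and possibly non-convex; $\|\cdot\|$ is the Euclidean norm. $f$ is $L$-smooth and $\rho$-Hessian Lipschitz: $\|\nabla f(x)-\nabla f(y)\|\le L\|x-y\|$, $\|\nabla^2 f(x)-\nabla^2 f(y)\|\le\rho\|x-y\|$ for all $x,y$. The stochastic gradient $g(x,\theta)$ satisfies $\mathbb{E}g(x,\theta)=\nabla f(x)$, $P(\|g(x,\theta)-\nabla f(x)\|\ge t)\le2\exp(-t^2/(2s^2))$, and $g(\cdot,\theta)$ is $\ell$-Lipschitz for every $\theta$. Iterates (perturbed asynchronous SGD): with mini-batch size $M$, learning rate $\eta>0$ and delays $0\le\tau_{t,i}\le T$, $$x_{t+1}=x_t-\eta\Big(\sum_{i=1}^M g(x_{t-\tau_{t,i}},\theta_{t,i})+\sqrt M\zeta_t\Big),\qquad\zeta_t\sim N(\mathbf 0,(r^2/d)\mathbf I).$$ The total noise at step $t$ is denoted $\sum_{m=1}^M\zeta_{t,m}=\sum_{i=1}^M\big(g(x_{t-\tau_{t,i}},\theta_{t,i})-\nabla f(x_{t-\tau_{t,i}})\big)+\sqrt M\zeta_t$. Terms with negative time index in sums are taken to be zero (and delayed indices $t-\tau_{t,i}$ are nonnegative). *)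

(* Defs.v *)
(* Libraries: Mathematical Components and MathComp-Analysis. *)
From HB Require Import structures.
From mathcomp Require Import all_boot all_order all_algebra.
From mathcomp Require Import all_classical all_reals all_analysis.
Set Implicit Arguments.
Unset Strict Implicit.
Unset Printing Implicit Defensive.
Import Order.TTheory GRing.Theory Num.Theory.
Import numFieldNormedType.Exports.
Local Open Scope classical_set_scope.
Local Open Scope ring_scope.

(* The norm [`|x|] of the library on 'rV[R]_d is the sup norm (it induces the
   same topology and the same notion of differentiability), so the Euclidean
   norm is defined here. *)
Definition enorm (R : realType) (d : nat) (x : 'rV[R]_d) : R :=
  Num.sqrt (\sum_(i < d) x 0 i ^+ 2).

(* The matrix norm induced by the Euclidean norm. *)
Definition opnorm (R : realType) (d : nat) (A : 'M[R]_d) : R :=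
  sup [set enorm (v *m A) | v in [set v : 'rV[R]_d | enorm v <= 1]].

Definition grad (R : realType) (d : nat) (f : 'rV[R]_d -> R^o) (x : 'rV[R]_d) :
    'rV[R]_d :=
  \row_(i < d) 'D_(delta_mx 0 i) f x.

Definition hessian (R : realType) (d : nat) (f : 'rV[R]_d -> R^o)
    (x : 'rV[R]_d) : 'M[R]_d :=
  \matrix_(i < d, j < d)
    'D_(delta_mx 0 i) (fun y => grad f y 0 j : R^o) x.

(* "Smooth" without a constant is read as continuously differentiable. *)
Definition smooth (R : realType) (d : nat) (f : 'rV[R]_d -> R^o) : Prop :=
  (forall x : 'rV[R]_d, differentiable f x) /\ continuous (grad f).

Definition L_smooth (R : realType) (d : nat) (L : R) (f : 'rV[R]_d -> R^o) :
    Prop :=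
  (forall x : 'rV[R]_d, differentiable f x) /\
  (forall x y : 'rV[R]_d, enorm (grad f x - grad f y) <= L * enorm (x - y)).

Definition hessian_Lipschitz (R : realType) (d : nat) (rho : R)
    (f : 'rV[R]_d -> R^o) : Prop :=
  [/\ (forall x : 'rV[R]_d, differentiable f x),
      (forall x : 'rV[R]_d, differentiable (grad f) x) &
      (forall x y : 'rV[R]_d,
         opnorm (hessian f x - hessian f y) <= rho * enorm (x - y))].

Definition mean_fun (R : realType) (d n : nat) (fs : 'I_n -> 'rV[R]_d -> R^o) :
    'rV[R]_d -> R^o :=
  fun x => n%:R^-1 * \sum_(i < n) fs i x.

(* The library has no sigma-algebra on 'rV[R]_d: measurability of a random
   vector is measurability of its coordinates. *)
Definition random_vector (R : realType) (dO : measure_display)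
    (Omega : measurableType dO) (d : nat) (X : Omega -> 'rV[R]_d) : Prop :=
  forall i : 'I_d, measurable_fun [set: Omega] (fun w => X w 0 i).

(* [normal_prob 0 0] of the library is not the Dirac mass, hence the case
   distinction. *)
Definition normal_law (R : realType) (s : R) (B : set R) : \bar R :=
  if s == 0 then \d_(0 : R) B else normal_prob 0 s B.

(* X ~ N(0, s^2 I): the law of X is the d-fold product of N(0, s^2), given by
   its values on measurable boxes. *)
Definition isotropic_gaussian (R : realType) (dO : measure_display)
    (Omega : measurableType dO) (P : probability Omega R) (d : nat) (s : R)
    (X : Omega -> 'rV[R]_d) : Prop :=
  random_vector X /\
  forall B : 'I_d -> set R, (forall i, measurable (B i)) ->
    P [set w | forall i, B i (X w 0 i)] =
      (\big[*%E/1%E]_(i < d) normal_law s (B i))%E.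

(* [D] is the law of the sample theta; the tail bound only makes sense for
   thresholds t >= 0. *)
Record stochastic_gradient (R : realType) (dT : measure_display)
    (Theta : measurableType dT) (D : probability Theta R) (d : nat)
    (f : 'rV[R]_d -> R^o) (s l : R) (g : 'rV[R]_d -> Theta -> 'rV[R]_d) :
    Prop := StochasticGradient {
  sg_measurable : forall x, random_vector (g x) ;
  sg_integrable : forall x (i : 'I_d),
    D.-integrable [set: Theta] (EFin \o (fun th => g x th 0 i)) ;
  sg_unbiased : forall x (i : 'I_d),
    ('E_D[fun th => (g x th 0 i)%R] = (grad f x 0 i)%:E)%E ;
  sg_tail : forall x (t : R), 0 <= t ->
    (D [set th | t <= enorm (g x th - grad f x)]%R
      <= (2 * expR (- t ^+ 2 / (2 * s ^+ 2)))%:E)%E ;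
  sg_Lipschitz : forall th x y, enorm (g x th - g y th) <= l * enorm (x - y)
}.

(* Perturbed asynchronous SGD. The subtraction t - tau t i w is truncated, but
   is used under the assumption tau t i w <= t, where it is exact. *)
Record async_sgd (R : realType) (dT dO : measure_display)
    (Theta : measurableType dT) (D : probability Theta R)
    (Omega : measurableType dO) (P : probability Omega R) (d M T : nat)
    (eta r : R) (g : 'rV[R]_d -> Theta -> 'rV[R]_d)
    (theta : nat -> 'I_M -> {RV P >-> Theta})
    (zeta : nat -> Omega -> 'rV[R]_d)
    (tau : nat -> 'I_M -> {RV P >-> nat})
    (x : nat -> Omega -> 'rV[R]_d) : Prop := AsyncSGD {
  sgd_sample : forall t i (A : set Theta), measurable A ->
    distribution P (theta t i) A = D A ;
  sgd_gaussian : forall t,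
    isotropic_gaussian P (Num.sqrt (r ^+ 2 / d%:R)) (zeta t) ;
  sgd_delay : forall t i w, (tau t i w <= T)%N ;
  sgd_delay_nonneg : forall t i w, (tau t i w <= t)%N ;
  sgd_init : random_vector (x 0) ;
  sgd_step : forall t w,
    x t.+1 w = x t w - eta *:
      (\sum_(i < M) g (x (t - tau t i w)%N w) (theta t i w)
       + Num.sqrt M%:R *: zeta t w)
}.

(* Only the sum over m of the zeta_{t,m} is prescribed. *)
Definition total_noise_decomposition (R : realType) (dT dO : measure_display)
    (Theta : measurableType dT) (Omega : measurableType dO)
    (P : probability Omega R) (d M : nat) (f : 'rV[R]_d -> R^o)
    (g : 'rV[R]_d -> Theta -> 'rV[R]_d)
    (theta : nat -> 'I_M -> {RV P >-> Theta})
    (zeta : nat -> Omega -> 'rV[R]_d)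
    (tau : nat -> 'I_M -> {RV P >-> nat})
    (x : nat -> Omega -> 'rV[R]_d)
    (noise : nat -> 'I_M -> Omega -> 'rV[R]_d) : Prop :=
  forall t w,
    \sum_(m < M) noise t m w =
      \sum_(i < M) (g (x (t - tau t i w)%N w) (theta t i w)
                    - grad f (x (t - tau t i w)%N w))
      + Num.sqrt M%:R *: zeta t w.

Definition maximal_delay (R : realType) (dO : measure_display)
    (Omega : measurableType dO) (P : probability Omega R) (d M : nat)
    (tau : nat -> 'I_M -> {RV P >-> nat})
    (x : nat -> Omega -> 'rV[R]_d) (taumax : nat -> {RV P >-> nat}) : Prop :=
  forall k w, exists2 m : 'I_M, taumax k w = tau k m w &
    forall m' : 'I_M, enorm (x k w - x (k - tau k m' w)%N w)
                      <= enorm (x k w - x (k - tau k m w)%N w).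

(* Main.v *)
(* Fix the sample point w and write S_k for the sum over m of the delayed
   gradients grad f (x_{k - tau_{k,m}}), s_k = |S_k| / M, g_k = |grad f (x_k)|,
   W = [t0, t0 + t). Young's inequality |A + N|^2 <= 3/2 |A|^2 + 3 |N|^2
   reduces the claim to an upper bound on (sum_W s_k)^2 / (2 t), which is the
   maximum over nu of sum_W (nu s_k - nu^2 / 2). By L-smoothness
   s_k <= g_k + u_k + v_k, where u_k = la sum_{k - T <= j < k} s_j,
   la = |L| eta M and v_k is the noise part; whence
   nu s_k - nu^2 / 2 <= g_k^2 + 2 u_k^2 + 2 v_k^2.

   Each s_j is at most g_i for some i in [j - T, j], and s_j enters at most T
   of the u_k. Hence g_i may be charged by the T + 1 steps j in [i, i + T], and
   this count gives T^2 (T + 1) instead of T^3. The bound T^3 survives because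
   such an excess is always compensated. If i itself is in W, then s_i <= g_i
   and step i needs only g_i^2 / 2. At most one i < t0 can be overcharged; then
   s_{t0}, ..., s_{i+T} all come from x_i, and the compensation is found in the
   steps following t0: the next step k = i + T + 1 has s_k <= g_{i'} for some i'
   in (i, i + T], and the Legendre form lets one use g_{i'} for both i' and k.
   If 2 la^2 T^2 >= 1/2, the trivial bound s_k <= g_i is enough. *)

Require Import Defs.
From HB Require Import structures.
From mathcomp Require Import all_boot all_order all_algebra.
From mathcomp Require Import all_classical all_reals all_analysis.
From mathcomp Require Import zify ring lra.
Set Implicit Arguments.
Unset Strict Implicit.
Unset Printing Implicit Defensive.
Import Order.TTheory GRing.Theory Num.Theory.
Import numFieldNormedType.Exports.
Local Open Scope classical_set_scope.
Local Open Scope ring_scope.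

(** * Scalar inequalities in Legendre form, with explicit budgets *)

Section Scalar.
Variable R : realFieldType.
Implicit Types nu s g u v y z : R.

(** Completing squares: against [c * z ^+ 2] the term [nu * z] costs [nu ^+ 2 / (4 * c)], and 1/4 +
    1/8 + 1/8 = 1/2. *)
Lemma legendre_step nu s g u v : 0 <= nu -> s <= g + u + v ->
  nu * s - nu ^+ 2 / 2 <= g ^+ 2 + 2 * u ^+ 2 + 2 * v ^+ 2.
Proof.
move=> nu0 hs; have h1 : nu * s <= nu * (g + u + v) by rewrite ler_wpM2l.
have := sqr_ge0 (g - nu / 2); have := sqr_ge0 (u - nu / 4).
have := sqr_ge0 (v - nu / 4); lra.
Qed.

(** The two bounds on [s'] are averaged with equal weights. A third of the budget [2 * u' ^+ 2] then
    suffices, and [slack_pair] keeps the rest. *)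
Lemma legendre_pair nu s g u v s' y u' v' : 0 <= nu ->
  s <= g + u + v -> s' <= g -> s' <= y + u' + v' ->
  nu * s - nu ^+ 2 / 2 + (nu * s' - nu ^+ 2 / 2) <=
  g ^+ 2 + 2 * u ^+ 2 + 2 * v ^+ 2
  + (y ^+ 2 + 2 / 3 * u' ^+ 2 + 2 * v' ^+ 2).
Proof.
move=> nu0 hs hg hs'; have h1 : nu * s <= nu * (g + u + v) by rewrite ler_wpM2l.
have h2 : nu * s' <= nu * g by rewrite ler_wpM2l.
have h3 : nu * s' <= nu * (y + u' + v') by rewrite ler_wpM2l.
have := sqr_ge0 (g - 3 / 4 * nu); have := sqr_ge0 (u - nu / 4).
have := sqr_ge0 (v - nu / 4); have := sqr_ge0 (y - nu / 4).
have := sqr_ge0 (u' - 3 / 8 * nu); have := sqr_ge0 (v' - nu / 8); lra.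
Qed.

(** The bounds on [s1] get weights 2/3 and 1/3, those on [s2] weights 1/4 and 3/4. What is left of
    [2 * u ^+ 2] and [2 * u1 ^+ 2] has coefficients 1/2 and 3/2, together one full budget. *)
Lemma legendre_chain nu s g u v s1 y u1 v1 s2 z u2 v2 : 0 <= nu ->
  s <= g + u + v -> s1 <= g -> s1 <= y + u1 + v1 ->
  s2 <= y -> s2 <= z + u2 + v2 ->
  nu * s - nu ^+ 2 / 2 + (nu * s1 - nu ^+ 2 / 2) + (nu * s2 - nu ^+ 2 / 2) <=
  g ^+ 2 + 3 / 2 * u ^+ 2 + 2 * v ^+ 2
  + (y ^+ 2 + 1 / 2 * u1 ^+ 2 + 2 * v1 ^+ 2)
  + (z ^+ 2 + 2 * u2 ^+ 2 + 2 * v2 ^+ 2).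
Proof.
move=> nu0 hs hg hs1 hy hs2.
have h1 : nu * s <= nu * (g + u + v) by rewrite ler_wpM2l.
have h2 : nu * s1 <= nu * g by rewrite ler_wpM2l.
have h3 : nu * s1 <= nu * (y + u1 + v1) by rewrite ler_wpM2l.
have h4 : nu * s2 <= nu * y by rewrite ler_wpM2l.
have h5 : nu * s2 <= nu * (z + u2 + v2) by rewrite ler_wpM2l.
have := sqr_ge0 (g - 5 / 6 * nu); have := sqr_ge0 (u - nu / 3).
have := sqr_ge0 (v - nu / 4); have := sqr_ge0 (y - 7 / 24 * nu).
have := sqr_ge0 (u1 - 1 / 3 * nu); have := sqr_ge0 (v1 - nu / 12).
have := sqr_ge0 (z - 3 / 8 * nu); have := sqr_ge0 (u2 - 3 / 16 * nu).
have := sqr_ge0 (v2 - 3 / 16 * nu); have := sqr_ge0 nu; lra.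
Qed.

(** An additional budget [2 * d * g ^+ 2] buys [d / 3 * s ^+ 2]: once [nu] is eliminated and [u],
    [v] are merged into their sum, a binary quadratic form remains. *)
Lemma legendre_slack nu d s g u v : 0 <= d <= 1 / 2 -> 0 <= s ->
  s <= g + u + v ->
  nu * s - nu ^+ 2 / 2 + d / 3 * s ^+ 2 <=
  (1 + 2 * d) * g ^+ 2 + 2 * u ^+ 2 + 2 * v ^+ 2.
Proof.
move=> /andP[d0 d1] s0 hs.
have h1 : nu * s - nu ^+ 2 / 2 <= s ^+ 2 / 2 by have := sqr_ge0 (s - nu); lra.
have h2 : s ^+ 2 <= (g + u + v) ^+ 2 by rewrite ler_sqr ?nnegrE //; lra.
have h3 : (1 / 2 + d / 3) * s ^+ 2 <= (1 / 2 + d / 3) * (g + u + v) ^+ 2.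
  by rewrite ler_wpM2l //; lra.
suff : (1 / 2 + d / 3) * (g + u + v) ^+ 2 <=
  (1 + 2 * d) * g ^+ 2 + 2 * u ^+ 2 + 2 * v ^+ 2 by lra.
have h4 : (u + v) ^+ 2 <= 2 * u ^+ 2 + 2 * v ^+ 2.
  by have := sqr_ge0 (u - v); lra.
suff : (1 / 2 + d / 3) * (g + (u + v)) ^+ 2 <=
  (1 + 2 * d) * g ^+ 2 + (u + v) ^+ 2.
  by rewrite addrA; lra.
set w := u + v.
(* Times [1 / 2 + 5 / 3 * d], the form is this square plus [d * (1 - 2 * d) / 3 * w ^+ 2]. *)
have : 0 <= ((1 / 2 + 5 / 3 * d) * g - (1 / 2 + d / 3) * w) ^+ 2 
  by exact: sqr_ge0.
have : 0 <= d * (1 - 2 * d) * w ^+ 2.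
  by rewrite mulr_ge0 ?sqr_ge0 // mulr_ge0 //; lra.
have hp : 0 < 1 / 2 + 5 / 3 * d by lra.
move=> A B; rewrite -subr_ge0 -(pmulr_rge0 _ hp).
nra.
Qed.
(** Times [T], with [X = T * x] fixed, the difference is affine in [T]: nonnegative at [T = p + 1],
    with slope at least [(X - 1) ^+ 2]. *)
Lemma delay_quadratic (T p x : R) : 1 <= p -> p + 1 <= T ->
  (2 * x - x ^+ 2) * T - p * (p + 1) / 2 <= T * (T - p) * x ^+ 2.
Proof.
move=> p1 pT; have T0 : 0 < T by lra.
set X := T * x.
rewrite -subr_ge0 -(pmulr_rge0 _ T0).
have -> : T * (T * (T - p) * x ^+ 2 - ((2 * x - x ^+ 2) * T - p * (p + 1) / 2))
  = X ^+ 2 * (T - p + 1) - 2 * X * T + T * (p * (p + 1) / 2).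
  by rewrite /X; field.
have key : 0 <= (X ^+ 2 * 2 - 2 * X * (p + 1) + (p + 1) * (p * (p + 1) / 2)).
  have : 0 <= (p + 1) ^+ 2 * (p - 1) by rewrite mulr_ge0 ?sqr_ge0 //; lra.
  have := sqr_ge0 (2 * X - (p + 1)); lra.
have : 0 <= (T - (p + 1)) * (X ^+ 2 - 2 * X + p * (p + 1) / 2).
  apply: mulr_ge0; first lra.
  have := sqr_ge0 (X - 1); nra.
lra.
Qed.

(** No single [nu] suits both [s0] and [x * s0]; this saves the fraction [1 - k = (1 - x) ^+ 2] of
    the budget [2 * u ^+ 2]. *)
Lemma legendre_far nu (s0 x y u v k : R) : 0 <= x <= 1 -> k = 2 * x - x ^+ 2 ->
  0 <= s0 -> x * s0 <= y + u + v ->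
  nu * s0 - nu ^+ 2 / 2 + (nu * (x * s0) - nu ^+ 2 / 2) <=
  s0 ^+ 2 / 2 + y ^+ 2 + 2 * v ^+ 2 + 2 * k * u ^+ 2.
Proof.
move=> /andP[x0 x1] -> s00 hs; set k' := 2 * x - _.
have k0 : 0 <= k' by rewrite /k'; nra.
have k3 : 0 < 3 * k' + 1 by lra.
have h1 : (x * s0) ^+ 2 <= (y + u + v) ^+ 2.
  by rewrite ler_sqr ?nnegrE //; have := mulr_ge0 x0 s00; lra.
(* Cauchy-Schwarz with weights 1, 2 and [2 * k'], cleared of denominators. *)
have h2 : 2 * k' * (y + u + v) ^+ 2
    <= (3 * k' + 1) * (y ^+ 2 + 2 * v ^+ 2 + 2 * k' * u ^+ 2).
  have := sqr_ge0 (y - 2 * v); have := sqr_ge0 (y - 2 * k' * u).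
  have := mulr_ge0 k0 (sqr_ge0 (y - 2 * v)).
  have := sqr_ge0 (v - k' * u).
  lra.
have h3 : 2 * k' * (x * s0) ^+ 2 <= 2 * k' * (y + u + v) ^+ 2.
  by rewrite ler_wpM2l //; lra.
(* The comparison that remains between the coefficients of [s0 ^+ 2], as a polynomial in [1 - x]. *)
have h4 : 0 <= (1 - x) ^+ 2 * (1/2 + (1 - x) - 5/4 * (1 - x) ^+ 2) * s0 ^+ 2.
  by rewrite !mulr_ge0 ?sqr_ge0 //; nra.
have h5 := mulr_ge0 (ltW k3) (sqr_ge0 (nu - (s0 + x * s0) / 2)).
rewrite -subr_ge0 -(pmulr_rge0 _ k3).
move: h2 h3 h4 h5; rewrite /k'; nra.
Qed.

(* 67 / 120 is close to the minimiser, where the value is below 1 / 3000. *)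
Lemma quartic_pos s : 0 <= s ->
  0 <= 29 / 4 * s ^+ 4 - 15 / 2 * s ^+ 3 + 4 * s ^+ 2 - 5 / 2 * s + 3 / 4.
Proof.
move=> s0.
have h : 0 <= (s - 67 / 120) ^+ 2 * (29 / 4 * s ^+ 2 + 143 / 240 * s + 12 / 5).
  by rewrite mulr_ge0 ?sqr_ge0 //; have := sqr_ge0 s; lra.
have := sqr_ge0 (s - 1 / 2); nra.
Qed.

(* The case T = 1, t = 2, in which the constants are almost sharp: minimising
   over [l] leaves the quartic above. *)
Lemma pair_delayed_norm l g w v y v' s : 0 <= l <= 1 / 2 ->
  1 <= g + w + v -> 0 <= s -> s <= g -> s <= y + l + v' ->
  (1 + s) ^+ 2 / 4 <=
  (1 + 2 * l ^+ 2) * g ^+ 2 + 2 * w ^+ 2 + 2 * v ^+ 2 + y ^+ 2 + 2 * v' ^+ 2.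
Proof.
move=> /andP[l0 l1] hs s0 sg hs'.
have lg : l ^+ 2 * s ^+ 2 <= l ^+ 2 * g ^+ 2.
  by rewrite ler_wpM2l ?sqr_ge0 // ler_sqr ?nnegrE //; lra.
have y1 : 0 <= y ^+ 2 + 2 * v' ^+ 2.
  by have := sqr_ge0 y; have := sqr_ge0 v'; lra.
have y2 : l <= s -> 2 / 3 * (s - l) ^+ 2 <= y ^+ 2 + 2 * v' ^+ 2.
  move=> ls; have : (s - l) ^+ 2 <= (y + v') ^+ 2.
    by rewrite ler_sqr ?nnegrE //; lra.
  by have := sqr_ge0 (y - 2 * v'); lra.
(* The second factor on the right has minimum [2 * s ^+ 4 / (1 + 3 * s ^+ 2)] over [l]. *)
have y3 : 2 * s ^+ 4 <=
    (1 + 3 * s ^+ 2) * (2 * l ^+ 2 * s ^+ 2 + 2 / 3 * (s - l) ^+ 2).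
  by have := sqr_ge0 ((1 + 3 * s ^+ 2) * l - s); lra.
have p3 : 0 < 1 + 3 * s ^+ 2 by have := sqr_ge0 s; lra.
have [g1|g1] := leP 1 g.
  have : (1 + s) ^+ 2 <= (2 * g) ^+ 2 by rewrite ler_sqr ?nnegrE //; lra.
  have := mulr_ge0 (sqr_ge0 l) (sqr_ge0 g).
  have := sqr_ge0 w; have := sqr_ge0 v; lra.
have wv : (1 - g) ^+ 2 <= 2 * w ^+ 2 + 2 * v ^+ 2.
  have : (1 - g) ^+ 2 <= (w + v) ^+ 2 by rewrite ler_sqr ?nnegrE //; lra.
  by have := sqr_ge0 (w - v); lra.
have [sh|sh] := leP (1 / 2) s.
  have gs : s ^+ 2 + (1 - s) ^+ 2 <= g ^+ 2 + (1 - g) ^+ 2.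
    have : 0 <= (g - s) * (g + s - 1) by rewrite mulr_ge0 //; lra.
    lra.
  have ls : l <= s by lra.
  suff : 0 <= 2 * l ^+ 2 * s ^+ 2 + 2 / 3 * (s - l) ^+ 2
    + (s ^+ 2 + (1 - s) ^+ 2 - (1 + s) ^+ 2 / 4) by move: (y2 ls); lra.
  rewrite -(pmulr_rge0 _ p3).
  by have := quartic_pos s0; lra.
have gs : 1 / 2 <= g ^+ 2 + (1 - g) ^+ 2 by have := sqr_ge0 (g - 1/2); lra.
have [ls|ls] := leP l s.
  suff : 0 <= 2 * l ^+ 2 * s ^+ 2 + 2 / 3 * (s - l) ^+ 2
    + (1 / 2 - (1 + s) ^+ 2 / 4) by move: (y2 ls); lra.
  rewrite -(pmulr_rge0 _ p3).
  suff : 0 <= 5 / 4 * s ^+ 4 - 3 / 2 * s ^+ 3 + 1 / 2 * s ^+ 2 - 1 / 2 * s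
    + 1 / 4.
    by lra.
  nra.
have : s ^+ 2 * s ^+ 2 <= l ^+ 2 * s ^+ 2.
  by rewrite ler_wpM2r ?sqr_ge0 // ler_sqr ?nnegrE //; lra.
have := sqr_ge0 (s ^+ 2 - 3 / 16); nra.
Qed.

(** The best [nu] is [(s0 + s) / 2]; homogeneity in all variables but [l] then reduces to
    [s0 = 1]. *)
Lemma pair_delayed nu l s0 g w v s y v' : 0 <= l -> 2 * l ^+ 2 <= 1 / 2 ->
  0 <= s0 -> s0 <= g + w + v -> 0 <= s -> s <= g -> s <= y + l * s0 + v' ->
  nu * s0 - nu ^+ 2 / 2 + (nu * s - nu ^+ 2 / 2) <=
  (1 + 2 * l ^+ 2) * g ^+ 2 + 2 * w ^+ 2 + 2 * v ^+ 2 + y ^+ 2 + 2 * v' ^+ 2.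
Proof.
move=> l0 l1 s00 hs0 hs sg hs'.
have l2 : 0 <= l <= 1 / 2 by rewrite l0 /=; nra.
suff h : (s0 + s) ^+ 2 / 4 <=
    (1 + 2 * l ^+ 2) * g ^+ 2 + 2 * w ^+ 2 + 2 * v ^+ 2 + y ^+ 2 + 2 * v' ^+ 2.
  by have := sqr_ge0 (nu - (s0 + s) / 2); lra.
move: s00; rewrite le0r => /orP[/eqP->|s00].
  have : s ^+ 2 <= g ^+ 2 by rewrite ler_sqr ?nnegrE //; lra.
  have := mulr_ge0 (sqr_ge0 l) (sqr_ge0 g).
  have := sqr_ge0 w; have := sqr_ge0 v; have := sqr_ge0 y; have := sqr_ge0 v'.
  have := sqr_ge0 g; lra.
have n0 := lt0r_neq0 s00.
have d t : t / s0 * s0 = t by rewrite divfK.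
have h := @pair_delayed_norm l (g / s0) (w / s0) (v / s0) (y / s0) (v' / s0)
  (s / s0) l2.
have h1 : 1 <= g / s0 + w / s0 + v / s0
  by rewrite -!mulrDl ler_pdivlMr // mul1r.
have h2 : s / s0 <= y / s0 + l + v' / s0.
  have -> : y / s0 + l + v' / s0 = (y + l * s0 + v') / s0 by field.
  by rewrite ler_pM2r ?invr_gt0.
have h3 : s / s0 <= g / s0 by rewrite ler_pM2r ?invr_gt0.
have {}h := h h1 (divr_ge0 hs (ltW s00)) h3 h2.
have := ler_wpM2r (sqr_ge0 s0) h.
have -> : (1 + s / s0) ^+ 2 / 4 * s0 ^+ 2 = (s0 + s) ^+ 2 / 4 by field.
suff -> : ((1 + 2 * l ^+ 2) * (g / s0) ^+ 2 + 2 * (w / s0) ^+ 2 +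
  2 * (v / s0) ^+ 2 + (y / s0) ^+ 2 + 2 * (v' / s0) ^+ 2) * s0 ^+ 2 =
  (1 + 2 * l ^+ 2) * g ^+ 2 + 2 * w ^+ 2 + 2 * v ^+ 2 + y ^+ 2 + 2 * v' ^+ 2
    by [].
by field.
Qed.

(* [s0] and [s] are the gradients at t0 and i + T + 1. The budget unused by a
   source between i and t0 pays for [s] when [s] is comparable to [s0];
   otherwise they are far apart, which the Legendre form penalises. *)
Lemma far_budget nu (c T p m C s0 s : R) y u v : 0 <= nu -> 0 <= c -> 0 <= m ->
  m <= s0 ^+ 2 ->
  2 * u ^+ 2 <= C -> c * T * m <= C -> 1 <= p -> p + 1 <= T ->
  0 < s0 -> 0 <= s -> s <= y + u + v ->
  nu * s0 - nu ^+ 2 / 2 + (nu * s - nu ^+ 2 / 2)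
    + c * m * (T - p * (p + 1) / 2) <=
  s0 ^+ 2 / 2 + (y ^+ 2 + 2 * v ^+ 2 + C) + c * T * (T - p) * s ^+ 2.
Proof.
move=> nu0 c0 m0 ms uC mC p1 pT s00 hs hs'.
have T0 : 0 <= T by lra.
have Tp : 0 <= T - p by lra.
have cT0 : 0 <= c * T by rewrite mulr_ge0.
(* If [s0 < s], then [m <= s ^+ 2], and since [T - p >= 1] the last budget alone pays
   [c * T * m]. *)
have [ss|ss] := leP s s0; last first.
  have h1 := legendre_step nu0 hs'; have h2 := sqr_ge0 (s0 - nu).
  have h3 : m <= s ^+ 2.
    by apply: (le_trans ms); rewrite ler_sqr ?nnegrE // ltW.
  have h4 : c * T * m <= c * T * s ^+ 2 by rewrite ler_wpM2l.
  have h5 : 0 <= c * T * s ^+ 2 * (T - p - 1).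
    by rewrite !mulr_ge0 ?sqr_ge0 //; lra.
  have h6 : 0 <= c * m * (p * (p + 1) / 2).
    by rewrite !mulr_ge0 //; lra.
  lra.
have n0 := lt0r_neq0 s00.
pose x := s / s0; have xs : x * s0 = s by rewrite /x divfK.
have x0 : 0 <= x by rewrite divr_ge0 // ltW.
have x1 : x <= 1 by rewrite ler_pdivrMr // mul1r.
have x01 : 0 <= x <= 1 by rewrite x0.
have h1 := @legendre_far nu s0 x y u v _ x01 erefl (ltW s00).
rewrite xs in h1; have {}h1 := h1 hs'.
have h2 := delay_quadratic x p1 pT.
set k := 2 * x - x ^+ 2 in h1 h2.
have k0 : 0 <= k.
  have : 0 <= x * (1 - x) by rewrite mulr_ge0 ?subr_ge0.
  by rewrite /k; lra.
have k1 : k <= 1 by rewrite /k; have := sqr_ge0 (1 - x); lra.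
(* [C] is shared: the fraction [k] covers [u], the fraction [1 - k] covers that part of [c * T * m].
   The rest falls on the budget in [s ^+ 2], by [delay_quadratic]. *)
have h3 : k * (2 * u ^+ 2) <= k * C by rewrite ler_wpM2l.
have h4 : (1 - k) * (c * T * m) <= (1 - k) * C by rewrite ler_wpM2l // subr_ge0.
have h5 : c * m * (k * T - p * (p + 1) / 2) <= c * T * (T - p) * s ^+ 2.
  rewrite -xs; have [kp|kp] := leP (k * T - p * (p + 1) / 2) 0.
    apply: (@le_trans _ _ 0); first by rewrite mulr_ge0_le0 ?mulr_ge0.
    by rewrite mulr_ge0 ?sqr_ge0 // mulr_ge0.
  have : c * m * (k * T - p * (p + 1) / 2) <=
    c * s0 ^+ 2 * (k * T - p * (p + 1) / 2).
    by rewrite ler_wpM2r ?(ltW kp) // ler_wpM2l.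
  have : c * s0 ^+ 2 * (k * T - p * (p + 1) / 2) <=
    c * s0 ^+ 2 * (T * (T - p) * x ^+ 2).
    by rewrite ler_wpM2l // mulr_ge0 ?sqr_ge0.
  lra.
lra.
Qed.
End Scalar.

Ltac nat_lia := repeat match goal with
  | H : ?A |- _ => lazymatch A with
    | is_true (leq _ _) => fail
    | is_true (andb _ _) => fail
    | is_true (negb _) => fail
    | @eq nat _ _ => fail
    | @eq (Equality.sort _) _ _ => fail
    | not (@eq nat _ _) => fail
    | _ => clear H
    end
  end; lia.

(** * Finite sums over natural numbers *)

Lemma sum_nat_indicator (R : pzSemiRingType) (m n N : nat) (P : pred nat)
    (F : nat -> R) : (n <= N)%N ->
  \sum_(m <= j < n | P j) F j
  = \sum_(0 <= j < N) (P j && (m <= j < n)%N)%:R * F j.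
Proof.
move=> nN; rewrite (big_nat_widenl _ 0%N) // (big_nat_widen _ _ N) //.
rewrite big_mkcond /=; apply: eq_bigr => j _.
by rewrite -andbA; case: ifP; rewrite ?mul1r ?mul0r.
Qed.

Lemma ler_sum_sub (R : numDomainType) (r l : seq nat) (F : nat -> R) :
  uniq l -> uniq r -> {subset l <= r} ->
  (forall k, k \in r -> k \notin l -> 0 <= F k) ->
  \sum_(k <- l) F k <= \sum_(k <- r) F k.
Proof.
move=> ul ur lr F0; rewrite [leRHS](bigID (mem l)) /=.
have -> : \sum_(k <- r | k \in l) F k = \sum_(k <- l) F k.
  rewrite -big_filter; apply: perm_big; apply: uniq_perm => //.
    exact: filter_uniq.
  by move=> k; rewrite mem_filter andb_idr // => /lr.
by rewrite lerDl big_seq_cond sumr_ge0 // => k /andP[kr kl]; exact: F0.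
Qed.

Lemma sqr_sum_le (R : realFieldType) (T k : nat) (s : nat -> R) :
  (\sum_(k - T <= j < k) s j) ^+ 2 <= T%:R * \sum_(k - T <= j < k) s j ^+ 2.
Proof.
suff h (l : seq nat) : (\sum_(j <- l) s j) ^+ 2 <=
  (size l)%:R * \sum_(j <- l) s j ^+ 2.
  apply: (le_trans (h _)); rewrite ler_wpM2r ?sumr_ge0 // => [j _|].
    exact: sqr_ge0.
  by rewrite ler_nat size_iota; nat_lia.
elim: l => [|a l IH]; first by rewrite !big_nil expr0n mul0r.
rewrite !big_cons /= -natr1; set S := \sum_(j <- l) s j in IH *.
set Q := \sum_(j <- l) s j ^+ 2 in IH *; set n : R := (size l)%:R in IH *.
have n0 : 0 <= n by exact: ler0n.
have [n00|np] := eqVneq n 0.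
  rewrite n00 in IH *; rewrite mul0r in IH.
  have -> : S = 0 by apply/eqP; rewrite -sqrf_eq0 eq_le IH sqr_ge0.
  have : 0 <= Q by apply: sumr_ge0 => j _; apply: sqr_ge0.
  lra.
have np' : 0 < n by rewrite lt_def np.
rewrite -subr_ge0 -(pmulr_rge0 _ np').
have := sqr_ge0 (n * s a - S); have := sqr_ge0 n.
have : 0 <= (n + 1) * (n * Q - S ^+ 2) by rewrite mulr_ge0 //; lra.
lra.
Qed.

Lemma sum_subn_triangle (p n : nat) : (p <= n)%N ->
  (2 * (\sum_(0 <= j < n) (p - j)) = p * p.+1)%N.
Proof.
elim: p n => [|p IH] n pn; first by rewrite big1.
case: n pn => // n pn; rewrite big_nat_recl // subn0 mulnDr.
by under eq_bigr do rewrite subSS; rewrite IH //; nat_lia.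
Qed.

(** * Charging the delayed steps to their sources *)

Section Budget.
Variables (R : realFieldType) (T n0 n1 : nat) (g s v : nat -> R) (la nu : R).
Variable src : nat -> nat.
Hypothesis g_ge0 : forall k, 0 <= g k.
Hypothesis s_ge0 : forall k, 0 <= s k.
Hypothesis la_ge0 : 0 <= la.
Hypothesis nu_ge0 : 0 <= nu.
Hypothesis srcP : forall j, (src j <= j <= src j + T)%N.
Hypothesis s_src : forall j, s j <= g (src j).
Hypothesis s_step : forall k, (n0 <= k < n1)%N ->
  s k <= g k + la * \sum_(k - T <= j < k) s j + v k.

(* [src j] is the iterate whose gradient dominates [s j]; [load j] counts the
   steps that charge [s j] to it, [coef * charge i] is the total charged to
   [g i ^+ 2], and [reserve i] is what remains of its budget. *)
Definition coef := 2 * la ^+ 2 * T%:R.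
Definition delayed k := src k != k.
Definition energy k := \sum_(k - T <= j < k) s j ^+ 2.
(** What step [k] leaves of its budget. An undelayed step hands half of [g k ^+ 2] over to
    [reserve k]. *)
Definition slack k := g k ^+ 2 + 2 * v k ^+ 2
  + (if delayed k then coef * energy k else - (g k ^+ 2 / 2))
  - (nu * s k - nu ^+ 2 / 2).
Definition charging k := [&& (n0 <= k)%N, (k < n1)%N & delayed k].
Definition load j : nat := \sum_(j.+1 <= k < (j + T).+1) charging k.
Definition charge i :=
  \sum_(i <= j < (i + T).+1 | src j == i) (load j)%:R * s j ^+ 2.
Definition hits i : nat := \sum_(i <= j < (i + T).+1 | src j == i) load j.
Definition reserve i := coef * T%:R ^+ 2 * g i ^+ 2
  + (if (n0 <= i)%N && ~~ delayed i then g i ^+ 2 / 2 else 0) - coef * charge i.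

Lemma coef_ge0 : 0 <= coef.
Proof. by rewrite /coef !mulr_ge0 ?sqr_ge0. Qed.

Lemma sqr_s_src j : s j ^+ 2 <= g (src j) ^+ 2.
Proof. by rewrite ler_sqr ?nnegrE. Qed.

Lemma drift_le k : 2 * (la * \sum_(k - T <= j < k) s j) ^+ 2 <= coef * energy k.
Proof.
have := sqr_sum_le T k s; rewrite -/(energy k) => hs.
have : la ^+ 2 * (\sum_(k - T <= j < k) s j) ^+ 2 <=
  la ^+ 2 * (T%:R * energy k).
  by rewrite ler_wpM2l ?sqr_ge0.
by rewrite /coef; lra.
Qed.

Lemma slack_ge0 k : (n0 <= k < n1)%N -> 0 <= slack k.
Proof.
move=> kW; have := legendre_step nu_ge0 (s_step kW); rewrite /slack.
case: ifP => [_|/negbFE/eqP kB]; first by have := drift_le k; lra.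
move=> _; have := sqr_s_src k; rewrite kB => hs.
by have := sqr_ge0 (s k - nu); have := sqr_ge0 (v k); lra.
Qed.

(** Double counting: [s j ^+ 2] occurs in [energy k] for [load j] charging steps [k]. A loaded [j]
    is at least [n0 - T], so its source is at least [n0 - 2 * T]. *)
Lemma sum_charges :
  \sum_(n0 <= k < n1 | delayed k) energy k
  = \sum_(n0 - 2 * T <= i < n1) charge i.
Proof.
(* A common range for all sums; no index from [N] on carries any load. *)
pose N := (n1 + T).+1.
have hN j : (j < N)%N -> (load j)%:R =
    \sum_(0 <= k < N) (charging k && (j < k <= j + T)%N)%:R :> R.
  move=> jN; rewrite /load natr_sum.
  rewrite (sum_nat_indicator _ xpredT _ (_ : ((j + T).+1 <= (N + T).+1)%N)) /=;
    last by nat_lia.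
  rewrite (@big_cat_nat _ _ _ N 0 (N + T).+1) //=; last by rewrite /N; nat_lia.
  rewrite [X in _ + X]big_nat_cond [X in _ + X]big1 ?addr0 => [|k].
    apply: eq_bigr => k _; rewrite -natrM mulnb ltnS andbC.
    by congr ((_ && _)%:R).
  rewrite andbT => /andP[Nk _]; rewrite -natrM mulnb.
  suff -> : charging k = false by rewrite andbF.
  by move: Nk; rewrite /charging /N; nat_lia.
transitivity (\sum_(0 <= j < N) (load j)%:R * s j ^+ 2).
  rewrite [LHS](sum_nat_indicator _ _ _ (_ : (n1 <= N)%N));
    last by rewrite /N; nat_lia.
  have DE k : (0 <= k < N)%N ->
      energy k = \sum_(0 <= j < N) ((k - T <= j < k)%N)%:R * s j ^+ 2.
    move=> kN; rewrite /energy.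
    by rewrite (sum_nat_indicator _ xpredT _ (_ : (k <= N)%N)) //; nat_lia.
  under [LHS]eq_big_nat => k kN do rewrite DE // mulr_sumr.
  rewrite exchange_big /=; apply: eq_big_nat => j /andP[_ jN].
  rewrite hN // mulr_suml; apply: eq_bigr => k _.
  rewrite mulrA -natrM mulnb; congr (_%:R * _); congr nat_of_bool.
  by rewrite /charging; nat_lia.
rewrite [RHS](sum_nat_indicator _ xpredT _ (_ : (n1 <= N)%N)) /=;
  last by rewrite /N; nat_lia.
have HE i : (0 <= i < N)%N -> charge i = \sum_(0 <= j < N + T)
    ((src j == i) && (i <= j < (i + T).+1)%N)%:R * ((load j)%:R * s j ^+ 2).
  move=> iN; rewrite /charge.
  by rewrite (sum_nat_indicator _ _ _ (_ : (_ <= N + T)%N)) //; nat_lia.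
under [RHS]eq_big_nat => i iN do rewrite HE // mulr_sumr.
rewrite exchange_big /= (@big_cat_nat _ _ _ N 0 (N + T)) //=; last by nat_lia.
rewrite [X in _ = _ + X]big_nat_cond [X in _ = _ + X]big1 ?addr0; last first.
  move=> j /andP[/andP[Nj _] _].
  have -> : load j = 0%N.
    rewrite /load big_nat_cond big1 // => k; rewrite andbT => /andP[jk _].
    by move: Nj jk; rewrite /charging /N; nat_lia.
  by rewrite big1 // => i _; rewrite mul0r !mulr0.
apply: eq_big_nat => j /andP[_ jN].
under eq_bigr do rewrite mulrA; rewrite -mulr_suml.
have [->|hj] := eqVneq (load j) 0%N; first by rewrite mul0r mulr0.
have {hj} [k kj Wk] : exists2 k, (j < k < (j + T).+1)%N & charging k.
  have /hasP[k] : has charging (index_iota j.+1 (j + T).+1).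
    apply/negPn/negP => /hasPn hn; case/negP: hj; apply/eqP.
    by rewrite /load big_seq big1 // => k /hn /negbTE; rewrite /charging => ->.
  by rewrite mem_index_iota => *; exists k.
have imr : src j \in index_iota 0 N.
  by rewrite mem_index_iota; have := srcP j; move: jN; nat_lia.
rewrite (bigD1_seq (src j)) ?iota_uniq //=.
rewrite big1 ?addr0 => [|i /negbTE ni]; last by rewrite eq_sym ni mulr0.
rewrite eqxx /=; have := srcP j; move: Wk kj; rewrite /charging => *.
by rewrite (_ : _ && _ = true) 1?(_ : _ && _ = true) ?mul1r //; nat_lia.
Qed.

(** The energies cancel against the charges, the handed-over halves against each other, and
    [coef * T%:R ^+ 2] is the constant with [T%:R ^+ 3]. *)
Lemma sum_slacks :
  \sum_(n0 <= k < n1) slack k + \sum_(n0 - 2 * T <= i < n1) reserve i =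
  \sum_(n0 <= k < n1) g k ^+ 2 + 2 * \sum_(n0 <= k < n1) v k ^+ 2
  + 2 * la ^+ 2 * T%:R ^+ 3 * \sum_(n0 - 2 * T <= i < n1) g i ^+ 2
  - \sum_(n0 <= k < n1) (nu * s k - nu ^+ 2 / 2).
Proof.
set Z := \sum_(n0 <= k < n1) (nu * s k - _).
rewrite /slack /reserve !big_split /= !sumrN -!mulr_sumr -sum_charges -/Z.
have -> : \sum_(n0 <= k < n1)
    (if delayed k then coef * energy k else - (g k ^+ 2 / 2)) =
  coef * \sum_(n0 <= k < n1 | delayed k) energy k
  - \sum_(n0 <= k < n1 | ~~ delayed k) g k ^+ 2 / 2.
  rewrite (bigID delayed) /= mulr_sumr -sumrN; congr (_ + _).
    by apply: eq_bigr => k ->.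
  by apply: eq_bigr => k /negbTE ->.
have -> : \sum_(n0 - 2 * T <= i < n1)
    (if (n0 <= i)%N && ~~ delayed i then g i ^+ 2 / 2 else 0) =
  \sum_(n0 <= k < n1 | ~~ delayed k) g k ^+ 2 / 2.
  rewrite [RHS](big_nat_widenl _ (n0 - 2 * T)%N) ?leq_subr //.
  rewrite [RHS]big_mkcond /=.
  by apply: eq_bigr => i _; rewrite andbC.
by rewrite /coef; ring.
Qed.

(** * Bounds on loads, hits and reserves *)

Lemma load_count j : load j = count charging (index_iota j.+1 (j + T).+1).
Proof.
rewrite /load -sum1_count [RHS]big_mkcond.
by apply: eq_bigr => k _; case: charging.
Qed.

Lemma load_le j : (load j <= T)%N.
Proof.
rewrite load_count (leq_trans (count_size _ _)) // size_iota; nat_lia.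
Qed.

Lemma load_lt j k : (j < k <= j + T)%N -> ~~ charging k -> (load j < T)%N.
Proof.
move=> jk nW; rewrite load_count.
have e : size (index_iota j.+1 (j + T).+1) = T by rewrite size_iota; nat_lia.
rewrite -[ltnRHS]e ltn_neqAle count_size andbT -all_count.
by apply/negP => /allP /(_ k); rewrite mem_index_iota ltnS jk => /(_ isT);
  exact/negP.
Qed.

(** Only steps from [n0] on charge, so the load of an early index is cut off at the start of the
    window. *)
Lemma load_early j : (load j + n0 <= maxn n0 (j + T).+1)%N.
Proof.
rewrite load_count -size_filter.
have /leq_trans -> // :
    (size (seq.filter charging (index_iota j.+1 (j + T).+1)) + n0
    <= size (index_iota n0 (j + T).+1) + n0)%N.
  rewrite leq_add2r uniq_leq_size ?filter_uniq ?iota_uniq // => k.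
  by rewrite mem_filter !mem_index_iota /charging; nat_lia.
by rewrite size_iota; nat_lia.
Qed.

Lemma hits_le (l : seq nat) i :
  (forall j, (i <= j <= i + T)%N -> src j = i -> load j != 0%N -> j \in l) ->
  (hits i <= T * size l)%N.
Proof.
move=> hl; rewrite /hits (bigID (fun j => load j != 0%N)) /=.
rewrite [X in (_ + X)%N]big1 ?addn0 => [|j /andP[_ /negPn/eqP //]].
rewrite -big_filter; set r := seq.filter _ _.
have : (size r <= size l)%N.
  apply: uniq_leq_size; first by rewrite filter_uniq // iota_uniq.
  move=> j; rewrite mem_filter mem_index_iota ltnS => 
    /andP[/andP[/eqP e hj] ij].
  exact: hl.
have : (\sum_(j <- r) load j <= \sum_(j <- r) T)%N.
  by apply: leq_sum => j _; apply: load_le.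
rewrite big_const_seq count_predT iter_addn_0 => h1 h2.
by rewrite (leq_trans h1) // leq_mul2l h2 orbT.
Qed.

Lemma reserve_hits i n : (hits i <= n)%N ->
  coef * (T%:R ^+ 2 - n%:R) * g i ^+ 2
    + (if (n0 <= i)%N && ~~ delayed i then g i ^+ 2 / 2 else 0) <= reserve i.
Proof.
move=> hn; suff : charge i <= n%:R * g i ^+ 2.
  move=> /(ler_wpM2l coef_ge0); rewrite /reserve; lra.
apply: (@le_trans _ _ ((hits i)%:R * g i ^+ 2)); last first.
  by rewrite ler_wpM2r ?sqr_ge0 // ler_nat.
rewrite /hits natr_sum mulr_suml; apply: ler_sum => j /eqP ji.
by rewrite ler_wpM2l // -ji sqr_s_src.
Qed.

(** For an index before the window, the only configuration in which [hits i] can exceed [T * T]. *)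
Definition saturated i := all (fun j => src j == i) (index_iota i (i + T).+1).

Lemma saturatedP i j : saturated i -> (i <= j <= i + T)%N -> src j = i.
Proof. by move=> /allP hf ij; apply/eqP/hf; rewrite mem_index_iota ltnS. Qed.

(** Of the [T + 1] indices that can have source [i] one drops out, and the others have load at most
    [T]. *)
Lemma hits_hole i j0 : (i <= j0 <= i + T)%N -> src j0 != i \/ load j0 = 0%N ->
  (hits i <= T * T)%N.
Proof.
move=> ij0 hj0; set l := rem j0 (index_iota i (i + T).+1).
have <- : size l = T.
  rewrite size_rem; last by rewrite mem_index_iota ltnS.
  by rewrite size_iota; nat_lia.
rewrite {1}(_ : size l = T).
  apply: hits_le => j ij ji hj; rewrite mem_rem_uniq ?iota_uniq //.
  rewrite inE mem_index_iota ltnS ij andbT; apply/eqP => e.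
  by case: hj0; rewrite -e ?ji ?eqxx // => h0; rewrite h0 in hj.
rewrite size_rem; last by rewrite mem_index_iota ltnS.
by rewrite size_iota; nat_lia.
Qed.

Lemma reserve_ge0_hits i : (hits i <= T * T)%N -> 0 <= reserve i.
Proof.
move=> /reserve_hits; rewrite natrM; apply: le_trans.
rewrite -expr2 subrr mulr0 mul0r add0r; case: ifP => // _.
by rewrite divr_ge0 ?sqr_ge0.
Qed.

Hypothesis cT : coef * T%:R <= 1 / 2.

(** In the window, a delayed [i] is itself a hole; for an undelayed one the excess
    [coef * T%:R * g i ^+ 2] is paid by the half received, by [cT]. Before the window, either some
    index has another source or [i] carries no load. *)
Lemma reserve_ge0 i : ~~ [&& saturated i, (n0 <= i + T)%N & (i < n0)%N] ->
  0 <= reserve i.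
Proof.
move=> nf; have [n0i|n0i] := leqP n0 i; last first.
  apply: reserve_ge0_hits; move: nf; rewrite n0i andbT negb_and.
  move=> /orP[/allPn[j0]|nn].
    by rewrite mem_index_iota ltnS => ij0 ?; apply: (hits_hole ij0); left.
  apply: (@hits_hole i i); first by nat_lia.
  right; have := load_early i; nat_lia.
have [Bi|nBi] := boolP (delayed i).
  apply: reserve_ge0_hits; apply: (@hits_hole i i); first by nat_lia.
  by left.
have : (hits i <= T * size (index_iota i (i + T).+1))%N.
  by apply: hits_le => j ij _ _; rewrite mem_index_iota ltnS.
rewrite size_iota (_ : _ - i = T.+1)%N; last by nat_lia.
move=> /reserve_hits; apply: le_trans; rewrite n0i nBi /= natrM -natr1.
have : 0 <= (1 / 2 - coef * T%:R) * g i ^+ 2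
  by rewrite mulr_ge0 ?sqr_ge0 ?subr_ge0.
lra.
Qed.

(** The excess over [T%:R ^+ 2 * g i ^+ 2] can be measured by the least [s j ^+ 2], and the [p]
    indices between [i] and [n0] reduce it through their truncated loads. *)
Lemma reserve_saturated i m p : saturated i -> (n0 <= i + T)%N ->
  (i + p.+1 = n0)%N -> 0 <= m ->
  (forall j, (i <= j <= i + T)%N -> m <= s j ^+ 2) ->
  (exists2 j, (i <= j <= i + T)%N & s j ^+ 2 = m) ->
  - (coef * m * (T%:R - p%:R * (p%:R + 1) / 2)) <= reserve i.
Proof.
move=> fi iT ip m0 hm [j0 ij0 e0].
have gi := g_ge0 i.
have -> : reserve i = coef * T%:R ^+ 2 * g i ^+ 2 - coef * charge i.
  by rewrite /reserve (_ : (n0 <= i)%N = false) /= ?addr0 //; nat_lia.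
suff : charge i <= T%:R ^+ 2 * g i ^+ 2 + m * (T%:R - p%:R * (p%:R + 1) / 2).
  by move=> /(ler_wpM2l coef_ge0); lra.
have -> : charge i = \sum_(i <= j < (i + T).+1) (load j)%:R * s j ^+ 2.
  rewrite /charge big_nat_cond [RHS]big_nat_cond; apply: eq_bigl => j.
  rewrite andbT ltnS; case: (boolP (i <= j <= i + T)%N) => //.
  by move=> /(saturatedP fi) ->; rewrite eqxx.
(* Only the part of [s j ^+ 2] above [m] is charged with the full load [T]. *)
have h1 : \sum_(i <= j < (i + T).+1) (load j)%:R * s j ^+ 2 <=
   \sum_(i <= j < (i + T).+1) (T%:R * (s j ^+ 2 - m) + m * (load j)%:R).
  rewrite big_nat_cond [leRHS]big_nat_cond; apply: ler_sum => j.
  rewrite andbT ltnS => /hm mj.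
  have : 0 <= (T%:R - (load j)%:R) * (s j ^+ 2 - m).
    by rewrite mulr_ge0 ?subr_ge0 // ler_nat load_le.
  lra.
apply: (le_trans h1); rewrite big_split /= -!mulr_sumr big_split /=
  sumr_const_nat.
have h2 : \sum_(i <= j < (i + T).+1) s j ^+ 2 <= m + T%:R * g i ^+ 2.
  rewrite (bigD1_seq j0) ?iota_uniq ?mem_index_iota ?ltnS //= e0 lerD2l.
  rewrite -big_filter -rem_filter ?iota_uniq //.
  apply: (@le_trans _ _
    (\sum_(j <- rem j0 (index_iota i (i + T).+1)) g i ^+ 2)).
    rewrite big_seq [leRHS]big_seq; apply: ler_sum => j.
    rewrite mem_rem_uniq ?iota_uniq // inE mem_index_iota ltnS => /andP[_ ij].
    by rewrite -(saturatedP fi ij) sqr_s_src.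
  rewrite big_const_seq count_predT iter_addr addr0 size_rem ?mem_index_iota
    ?ltnS //.
  by rewrite size_iota (_ : _.-1 = T)%N ?mulr_natl //; nat_lia.
have h3 : (\sum_(i <= j < (i + T).+1) (load j)%:R : R) <=
   T%:R * (T%:R + 1) - p%:R * (p%:R + 1) / 2.
  (* The index [i + j] loses at least [p - j] charging steps, those before [n0]. *)
  have : (2 * \sum_(i <= j < (i + T).+1) load j + p * p.+1 <= 2 * (T * T.+1))%N.
    rewrite -(@sum_subn_triangle p T.+1) -?mulnDr ?leq_mul2l /=;
      last by nat_lia.
    rewrite -{1}[i]add0n big_addn -addnS addKn -big_split /=.
    have -> : (T * T.+1 = \sum_(0 <= j < T.+1) T)%N.
      by rewrite sum_nat_const_nat subn0 mulnC.
    rewrite big_nat_cond [leqRHS]big_nat_cond; apply: leq_sum => j.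
    rewrite andbT => /andP[_ jT]; have := load_early (j + i);
      have := load_le (j + i); nat_lia.
  rewrite -(ler_nat R) !natrD !natrM natr_sum -[p.+1%:R]natr1 -[T.+1%:R]natr1;
    lra.
have := ler_wpM2l (ler0n R T) h2; have := ler_wpM2l m0 h3.
rewrite -mulr_natl (_ : _ - i = T.+1)%N ?natr1 //; last by nat_lia.
rewrite -natr1; lra.
Qed.

Lemma slackE k : delayed k -> slack k =
  g k ^+ 2 + 2 * v k ^+ 2 + coef * energy k - (nu * s k - nu ^+ 2 / 2).
Proof. by rewrite /slack => ->. Qed.

Lemma load_late j : (n1 <= j.+1)%N -> load j = 0%N.
Proof.
move=> nj; rewrite /load big_nat_cond big1 // => k; rewrite andbT => jk.
by rewrite /charging; nat_lia.
Qed.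

(** The step [(i + T).+1] is missing from the load of each of the [T] indices after [i], so the
    total is at most [T + T * (T - 1)]. *)
Lemma reserve_ge0_next i : (0 < T)%N -> ~~ charging (i + T).+1 ->
  0 <= reserve i.
Proof.
move=> T0 nW; apply: reserve_ge0_hits.
have : (hits i <= \sum_(i <= j < (i + T).+1) load j)%N.
  by rewrite /hits big_mkcond; apply: leq_sum => j _; case: ifP.
move=> /leq_trans; apply; rewrite big_ltn; last by nat_lia.
have : (\sum_(i.+1 <= j < (i + T).+1) load j
    <= \sum_(i.+1 <= j < (i + T).+1) T.-1)%N.
  rewrite big_nat_cond [leqRHS]big_nat_cond; apply: leq_sum => j.
  rewrite andbT => ij; have := @load_lt j _ _ nW; nat_lia.
rewrite sum_nat_const_nat; have := load_le i; nia.
Qed.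


Lemma exists_min i : exists2 j0, (i <= j0 <= i + T)%N &
  forall j, (i <= j <= i + T)%N -> s j0 ^+ 2 <= s j ^+ 2.
Proof.
pose f (j : 'I_T.+1) := s (i + j) ^+ 2.
case: (@arg_minP _ _ _ ord0 xpredT f isT) => j0 _ hj0.
exists (i + j0)%N => [|j ij]; first by have := ltn_ord j0; nat_lia.
have jT : (j - i < T.+1)%N by nat_lia.
have := hj0 (Ordinal jT) isT; rewrite /f /= (_ : i + (j - i) = j)%N //; nat_lia.
Qed.

Lemma slack_pair a b : (n0 <= a < n1)%N -> (n0 <= b < n1)%N -> delayed a ->
  delayed b ->
  src b = a -> 2 / 3 * (coef * energy b) <= slack a + slack b.
Proof.
move=> aW bW Ba Bb ba; rewrite !slackE //.
have := legendre_pair nu_ge0 (s_step aW) (_ : s b <= g a) (s_step bW).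
rewrite -{1}ba s_src => /(_ isT).
by have := drift_le a; have := drift_le b; lra.
Qed.

Lemma slack_reserve q : (n0 <= q < n1)%N -> delayed q -> (2 <= T)%N ->
  (hits q <= T * (T - 2))%N -> coef * T%:R / 3 * s q ^+ 2 <=
    slack q + reserve q.
Proof.
move=> qW Bq T2 /reserve_hits; rewrite Bq andbF addr0 natrM natrB //.
have cT0 : 0 <= coef * T%:R <= 1 / 2 by rewrite cT mulr_ge0 ?coef_ge0.
have := legendre_slack nu cT0 (s_ge0 q) (s_step qW).
by rewrite slackE //; have := drift_le q; lra.
Qed.

(** * Compensation of the one overcharged source *)

Lemma sum_slacks_ge0 :
  0 <= \sum_(n0 <= k < n1) slack k + \sum_(n0 - 2 * T <= i < n1) reserve i.
Proof.
have SF l : uniq l -> {subset l <= index_iota n0 n1} ->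
    \sum_(k <- l) slack k <= \sum_(n0 <= k < n1) slack k.
  move=> ul lr; apply: ler_sum_sub => //; first exact: iota_uniq.
  by move=> k; rewrite mem_index_iota => /slack_ge0.
have F0 : 0 <= \sum_(n0 <= k < n1) slack k.
  by have := SF [::]; rewrite big_nil; apply.
have [/hasP[i]|none] := boolP (has saturated (index_iota (n0 - T) n0));
  last first.
  apply: addr_ge0 => //; apply: sumr_ge0 => i _; apply: reserve_ge0.
  apply: contraNN none => /and3P[fi iT i0].
  by apply/hasP; exists i => //; rewrite mem_index_iota; nat_lia.
rewrite mem_index_iota => /andP[iT in0] fi.
have T0 : (0 < T)%N by nat_lia.
(* Two saturated indices in this range are at most [T] apart, so the later one would have the
   earlier one as its source. *)
have E0 j : j != i -> 0 <= reserve j.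
  move=> ji; apply: reserve_ge0; apply: contraNN ji => /and3P[fj jT jn].
  have [ij|ij] := leqP i j.
    by rewrite -(saturatedP fi (_ : (i <= j <= i + T)%N)) ?(saturatedP fj) //;
      nat_lia.
  by rewrite -(saturatedP fj (_ : (j <= i <= j + T)%N)) ?(saturatedP fi) //;
    nat_lia.
have SE l : uniq l -> i \in l -> {subset l <= index_iota (n0 - 2 * T) n1} ->
    \sum_(j <- l) reserve j <= \sum_(n0 - 2 * T <= j < n1) reserve j.
  move=> ul il lr; apply: ler_sum_sub => //; first exact: iota_uniq.
  by move=> j _ jl; apply: E0; apply: contraNneq jl => ->.
have SE0 : 0 <= reserve i ->
  0 <= \sum_(n0 <= k < n1) slack k + \sum_(n0 - 2 * T <= i < n1) reserve i.
  move=> Ei; apply: addr_ge0 => //; apply: sumr_ge0 => j _.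
  by have [->|] := eqVneq j i; last exact: E0.
have [Wk|nWk] := boolP (charging (i + T).+1); last first.
  by apply: SE0; exact: reserve_ge0_next.
(* [k] is the first step after [i] whose source cannot be [i]. *)
move: Wk; have [k Ek] : exists k, k = (i + T).+1 by eexists.
rewrite -Ek => Wk.
have [n0k kn1 Bk] : [/\ (n0 <= k)%N, (k < n1)%N & delayed k] by apply/and3P.
have [i1 Ei1] : exists i1, i1 = src k by eexists.
have i1P : (i < i1 <= i + T)%N.
  by have := srcP k; move: Bk; rewrite /delayed -Ei1 => /eqP; nat_lia.
have [j0 ij0 hj0] := exists_min i.
have [m Em] : exists m, m = s j0 ^+ 2 by eexists.
rewrite -Em in hj0; have m0 : 0 <= m by rewrite Em sqr_ge0.
have [p Ep] : exists p, p = (n0 - i.+1)%N by eexists.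
have ip : (i + p.+1 = n0)%N by nat_lia.
have EI : - (coef * m * (T%:R - p%:R * (p%:R + 1) / 2)) <= reserve i.
  by apply: reserve_saturated => //; [nat_lia | exists j0].
have c0 := coef_ge0.
have hB j : (i < j <= i + T)%N -> delayed j.
  by move=> ij; rewrite /delayed (saturatedP fi) //; nat_lia.
(* The energy of [k] runs over exactly the [T] indices after [i], all with source [i]. *)
have Dk : T%:R * m <= energy k.
  have -> : T%:R * m = \sum_(i.+1 <= j < k) m.
    by rewrite sumr_const_nat mulr_natl Ek; congr (_ *+ _); nat_lia.
  rewrite /energy (_ : k - T = i.+1)%N; last by nat_lia.
  rewrite big_nat_cond [leRHS]big_nat_cond; apply: ler_sum => j.
  by rewrite andbT => ij; apply: hj0; nat_lia.
have cDk : coef * T%:R * m <= coef * energy k by rewrite -mulrA ler_wpM2l.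
have Wn0 : (n0 < n1)%N by nat_lia.
have pT : (p < T)%N by nat_lia.
have irange j : (i <= j < n1)%N -> (j \in index_iota (n0 - 2 * T) n1).
  by rewrite mem_index_iota; nat_lia.
have cm0 : 0 <= coef * m by rewrite mulr_ge0.
have [i1n0|n0i1] := ltnP i1 n0.
  have p1 : (1 <= p)%N by nat_lia.
  have hi1 : (hits i1 <= T * p)%N.
    apply: (@leq_trans (T * size (index_iota k (i1 + T).+1))%N).
      apply: hits_le => j ij ji1 _; rewrite mem_index_iota ltnS.
      have [jk|] := leqP j (i + T); last by nat_lia.
      by move: ji1; rewrite (saturatedP fi) //; nat_lia.
    by rewrite leq_mul2l size_iota; nat_lia.
  have EI1 := reserve_hits hi1; rewrite leqNgt i1n0 /= addr0 natrM in EI1.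
  have hF : s n0 ^+ 2 / 2 - (nu * s n0 - nu ^+ 2 / 2) <= slack n0.
    have n0W : (n0 <= n0 < n1)%N by nat_lia.
    rewrite slackE ?hB //; last by nat_lia.
    have := legendre_step (s_ge0 n0) (s_step n0W); have := drift_le n0.
    lra.
  have ms : m <= s n0 ^+ 2 by apply: hj0; nat_lia.
  have sg : s k ^+ 2 <= g i1 ^+ 2 by rewrite Ei1 sqr_s_src.
  have kW : (n0 <= k < n1)%N by nat_lia.
  have hk := s_step kW.
  have Fk := slackE Bk.
  have h1 : slack n0 + slack k <= \sum_(n0 <= k < n1) slack k.
    have := SF [:: n0; k]; rewrite !big_cons big_nil addr0; apply.
      by rewrite /= inE andbT; nat_lia.
    by move=> j; rewrite !inE mem_index_iota; nat_lia.
  have h2 : reserve i1 + reserve i <= \sum_(n0 - 2 * T <= i < n1) reserve i.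
    have := SE [:: i1; i]; rewrite !big_cons big_nil addr0; apply.
    - by rewrite /= inE andbT; nat_lia.
    - by rewrite !inE eqxx orbT.
    by move=> j; rewrite !inE => /orP[]/eqP->; apply: irange; nat_lia.
  have pR : (1 : R) <= p%:R by rewrite ler1n.
  have pTR : p%:R + 1 <= T%:R :> R by rewrite natr1 ler_nat.
  (* If [s n0 = 0], the least value [m] vanishes and so does the deficit. *)
  have := s_ge0 n0; rewrite le0r => /orP[/eqP s00|s00].
    have mm : m = 0 by apply/eqP; rewrite eq_le m0 andbT (le_trans ms) // s00
      expr0n.
    have := slack_ge0 kW; have := slack_ge0 (_ : (n0 <= n0 < n1)%N).
    have : 0 <= reserve i1 by apply: E0; nat_lia.
    move: EI; rewrite mm mulr0 mul0r oppr0.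
    move=> e1 e2 /(_ ltac:(nat_lia)) e3 e4; lra.
  have := far_budget nu_ge0 c0 m0 ms (drift_le k) cDk pR pTR s00 (s_ge0 k) hk.
  have : coef * (T%:R ^+ 2 - T%:R * p%:R) * s k ^+ 2 <=
    coef * (T%:R ^+ 2 - T%:R * p%:R) * g i1 ^+ 2.
    rewrite ler_wpM2l // mulr_ge0 // expr2 -mulrBr mulr_ge0 //; lra.
  lra.
have kW : (n0 <= k < n1)%N by nat_lia.
have Bi1 : delayed i1 by exact: hB.
have i1W : (n0 <= i1 < n1)%N by nat_lia.
have pair_k := slack_pair i1W kW Bi1 Bk (esym Ei1).
have Ei : reserve i <= \sum_(n0 - 2 * T <= i < n1) reserve i.
  have := SE [:: i]; rewrite big_seq1; apply => //; first by rewrite inE.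
  by move=> j; rewrite inE => /eqP->; apply: irange; nat_lia.
(* The pair [i1], [k] supplies two thirds of [coef * T%:R * m]; this is enough when
   [p * (p + 1) / 2] is at least [T / 3]. *)
have [Tp|pT3] := leqP (2 * T) (3 * (p * p.+1)).
  have h1 : slack i1 + slack k <= \sum_(n0 <= k < n1) slack k.
    have := SF [:: i1; k]; rewrite !big_cons big_nil addr0; apply.
      by rewrite /= inE andbT; nat_lia.
    by move=> j; rewrite !inE mem_index_iota => /orP[]/eqP->.
  have h2 : 2 * T%:R <= 3 * (p%:R * (p%:R + 1)) :> R.
    by rewrite natr1 -!natrM ler_nat.
  have h3 := ler_wpM2l cm0 h2; move: h1 h3 Ei EI pair_k cDk; lra.
(* The missing third comes from a further step [q] of the window on which little is charged. *)
have by_slack q : (n0 <= q <= i + T)%N -> q != i1 -> (2 <= T)%N ->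
    (hits q <= T * (T - 2))%N ->
    0 <= \sum_(n0 <= k < n1) slack k + \sum_(n0 - 2 * T <= i < n1) reserve i.
  move=> qP qi1 T2 hq.
  have qW : (n0 <= q < n1)%N by nat_lia.
  have Bq : delayed q by apply: hB; nat_lia.
  have h1 : slack i1 + (slack k + slack q) <= \sum_(n0 <= k < n1) slack k.
    have := SF [:: i1; k; q]; rewrite !big_cons big_nil addr0; apply.
      by rewrite /= !inE; nat_lia.
    by move=> j; rewrite !inE mem_index_iota => /or3P[]/eqP->.
  have h2 : reserve q + reserve i <= \sum_(n0 - 2 * T <= i < n1) reserve i.
    have := SE [:: q; i]; rewrite !big_cons big_nil addr0; apply.
    - by rewrite /= inE andbT; nat_lia.
    - by rewrite !inE eqxx orbT.
    by move=> j; rewrite !inE => /orP[]/eqP->; apply: irange; nat_lia.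
  have h3 := slack_reserve qW Bq T2 hq.
  have h4 : coef * T%:R / 3 * m <= coef * T%:R / 3 * s q ^+ 2.
    have iq : (i <= q <= i + T)%N by nat_lia.
    by apply: ler_wpM2l; [rewrite divr_ge0 ?mulr_ge0 | exact: hj0].
  have h5 : 0 <= coef * m * (p%:R * (p%:R + 1) / 2)
    by rewrite mulr_ge0 // divr_ge0 // mulr_ge0 // addr_ge0.
  move: h1 h2 h3 h4 h5 EI pair_k cDk; lra.
have hits_q q : (n0 <= q <= i + T)%N -> q != i1 ->
    (hits q <= T * (q + T - k))%N.
  move=> qP qi1.
  apply: (@leq_trans (T * size (index_iota k.+1 (q + T).+1))%N); last first.
    by rewrite leq_mul2l size_iota; nat_lia.
  apply: hits_le => j jq jmq _; rewrite mem_index_iota ltnS.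
  have [jT|jT] := leqP j (i + T).
    by move: jmq; rewrite (saturatedP fi); nat_lia.
  have [jk|jk] := eqVneq j k; last by nat_lia.
  by move: qi1; rewrite -jmq jk -Ei1 eqxx.
have [pT2|pT2] := leqP p.+3 T.
  have [i1e|i1e] := eqVneq i1 n0.
    apply: (by_slack n0.+1); [nat_lia | nat_lia | nat_lia |].
    apply: leq_trans (hits_q n0.+1 _ _) _; [nat_lia | nat_lia |].
    by rewrite leq_mul2l; nat_lia.
  apply: (by_slack n0); [nat_lia | nat_lia | nat_lia |].
  apply: leq_trans (hits_q n0 _ _) _; [nat_lia | nat_lia |].
  by rewrite leq_mul2l; nat_lia.
(* Now [T <= p + 2] and [3 * p * (p + 1) < 2 * T], which leaves [p = 0] and [T <= 2]. *)
have p0 : p = 0%N.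
  have [//|pp] := posnP p.
  have : (p * 2 <= p * p.+1)%N by rewrite leq_mul2l; nat_lia.
  nat_lia.
rewrite p0 !mul0r subr0 in EI.
have [T2|T2] := leqP 2 T.
  have [i1e|i1e] := eqVneq i1 n0; last first.
    apply: (by_slack n0); [nat_lia | nat_lia | nat_lia |].
    apply: leq_trans (hits_q n0 _ _) _; [nat_lia | nat_lia |].
    by rewrite leq_mul2l; nat_lia.
  (* Unless the charging step [k.+1] draws on [n0.+1], nothing is charged to [n0.+1], which serves
     as [q]. Otherwise these two form a second pair, and its surplus is the missing third. *)
  have [qk|qk] := boolP ((src k.+1 == n0.+1) && charging k.+1); last first.
    apply: (by_slack n0.+1); [nat_lia | nat_lia | nat_lia |].
    apply: (@leq_trans (T * size (Nil nat))%N); last by rewrite muln0.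
    apply: hits_le => j jq jmq hj.
    have [jT|jT] := leqP j (i + T).
      by move: jmq; rewrite (saturatedP fi); nat_lia.
    have [jk|jk] := eqVneq j k; first by move: jmq; rewrite jk -Ei1; nat_lia.
    have jk1 : j = k.+1 by nat_lia.
    case/negP: qk; rewrite -jk1 jmq eqxx /charging /delayed jmq.
    have [nj|nj] := leqP n1 j.+1; first by rewrite load_late in hj.
    by apply/and3P; split; [nat_lia | nat_lia | apply/eqP; nat_lia].
  move/andP: qk => [/eqP mk1 /and3P[_ k1n Bk1]].
  have qW : (n0 <= n0.+1 < n1)%N by nat_lia.
  have k1W : (n0 <= k.+1 < n1)%N by nat_lia.
  have Bq : delayed n0.+1 by apply: hB; nat_lia.
  have pair_k1 := slack_pair qW k1W Bq Bk1 mk1.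
  have Dk1 : m <= energy k.+1.
    apply: (@le_trans _ _ (s n0.+1 ^+ 2)); first by apply: hj0; nat_lia.
    rewrite /energy (_ : k.+1 - T = n0.+1)%N; last by nat_lia.
    rewrite big_ltn; last by nat_lia.
    by rewrite lerDl sumr_ge0 // => j _; apply: sqr_ge0.
  have h1 : slack i1 + (slack k + (slack n0.+1 + slack k.+1)) <=
      \sum_(n0 <= k < n1) slack k.
    have := SF [:: i1; k; n0.+1; k.+1]; rewrite !big_cons big_nil addr0; apply.
      by rewrite /= !inE; nat_lia.
    by move=> j; rewrite !inE mem_index_iota => /or4P[]/eqP->.
  have T2e : T = 2%N by nat_lia.
  have := ler_wpM2l c0 Dk1; rewrite T2e in cDk EI; lra.
have T1 : T = 1%N by nat_lia.
have i1e : i1 = n0 by nat_lia.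
have ke : k = n0.+1 by nat_lia.
have n0W : (n0 <= n0 < n1)%N by nat_lia.
have D1 a : (0 < a)%N -> energy a = s a.-1 ^+ 2.
  by move=> a0; rewrite /energy T1 subn1 big_ltn ?prednK // big_geq ?addr0 //
    prednK.
have S1 a : (0 < a)%N -> \sum_(a - T <= j < a) s j = s a.-1.
  by move=> a0; rewrite T1 subn1 big_ltn ?prednK // big_geq ?addr0 // prednK.
have n0p : n0.-1 = i by nat_lia.
have n0pos : (0 < n0)%N by nat_lia.
have Fn0 := slackE Bi1; rewrite i1e D1 // n0p in Fn0.
have Fk := slackE Bk; rewrite D1 ke //= in Fk.
have mi : m <= s i ^+ 2 by apply: hj0; nat_lia.
have mn0 : m <= s n0 ^+ 2 by apply: hj0; nat_lia.
have hn0 := s_step n0W; rewrite S1 // n0p in hn0.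
have hk := s_step kW; rewrite S1 ke //= in hk.
have skg : s n0.+1 <= g n0 by rewrite -ke -i1e Ei1 s_src.
have cE : coef = 2 * la ^+ 2 by rewrite /coef T1 mulr1.
have cT1 : coef <= 1 / 2 by have := cT; rewrite T1 mulr1.
rewrite T1 mulr1 in EI.
(* For [T = 1], a charging [k.+1] has source [k], which gives the chain [n0], [n0.+1], [n0.+2].
   Otherwise the reserve of [n0] is untouched. *)
have [Wk1|nWk1] := boolP (charging k.+1).
  have /and3P[n0k1 k1n Bk1] := Wk1.
  have k1W : (n0 <= k.+1 < n1)%N by nat_lia.
  have mk1 : src k.+1 = k.
    by have := srcP k.+1; move: Bk1; rewrite /delayed T1 => /eqP; nat_lia.
  have Fk1 := slackE Bk1; rewrite D1 //= ke in Fk1.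
  have hk1 := s_step k1W; rewrite S1 //= ke in hk1.
  have sk1 : s k.+1 <= g k by rewrite -{2}mk1 s_src.
  rewrite ke in sk1.
  have h1 : slack n0 + (slack n0.+1 + slack n0.+2) <=
      \sum_(n0 <= k < n1) slack k.
    have := SF [:: n0; n0.+1; n0.+2]; rewrite !big_cons big_nil addr0; apply.
      by rewrite /= !inE; nat_lia.
    by move=> j; rewrite !inE mem_index_iota => /or3P[]/eqP->; nat_lia.
  have h2 := legendre_chain nu_ge0 hn0 skg hk sk1 hk1.
  have h3 := ler_wpM2l c0 mi; have h4 := ler_wpM2l c0 mn0.
  move: h1 h2 h3 h4 Fn0 Fk Fk1 EI Ei; rewrite cE; lra.
have hits0 : (hits n0 <= 0)%N.
  rewrite -(muln0 T); apply: (@hits_le [::]) => j jn0 jm hj.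
  have [jT|jT] := leqP j (i + T).
    by move: jm; rewrite (saturatedP fi); nat_lia.
  have jk : j = k by nat_lia.
  have : (load j < 1)%N by rewrite -T1 (load_lt _ nWk1) //; nat_lia.
  by rewrite ltnS leqn0 (negbTE hj).
have En0 := reserve_hits hits0.
rewrite leqnn -i1e Bi1 /= addr0 subr0 T1 expr1n mulr1 i1e in En0.
have h1 : slack n0 + slack n0.+1 <= \sum_(n0 <= k < n1) slack k.
  have := SF [:: n0; n0.+1]; rewrite !big_cons big_nil addr0; apply.
    by rewrite /= !inE; nat_lia.
  by move=> j; rewrite !inE mem_index_iota => /orP[]/eqP->; nat_lia.
have h2 : reserve n0 + reserve i <= \sum_(n0 - 2 * T <= i < n1) reserve i.
  have := SE [:: n0; i]; rewrite !big_cons big_nil addr0; apply.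
  - by rewrite /= inE andbT; nat_lia.
  - by rewrite !inE eqxx orbT.
  by move=> j; rewrite !inE => /orP[]/eqP->; apply: irange; nat_lia.
have la2 : 2 * la ^+ 2 <= 1 / 2 by rewrite -cE.
(* After the smaller square has paid for [m], the larger one remains as the drift budget. *)
pose w := Num.max (s i) (s n0).
have hw : s n0 <= g n0 + la * w + v n0.
  apply: (le_trans hn0); rewrite lerD2r lerD2l ler_wpM2l //.
  by rewrite le_max lexx.
have h3 := pair_delayed nu la_ge0 la2 (s_ge0 n0) hw (s_ge0 n0.+1) skg hk.
have h4 : w ^+ 2 + m <= s i ^+ 2 + s n0 ^+ 2.
  by rewrite /w; case: (leP (s i) (s n0)) => _; lra.
have h5 := ler_wpM2l c0 h4.
move: h1 h2 h3 h5 Fn0 Fk EI En0; rewrite cE; lra.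
Qed.
End Budget.

(** * The case of large [la], and the bound on the squared mean *)

Lemma sum_fiber (R : pzSemiRingType) (r I : seq nat) (src : nat -> nat)
    (f : nat -> R) : uniq I -> {in r, forall k, src k \in I} ->
  \sum_(k <- r) f (src k) =
  \sum_(i <- I) (count (fun k => src k == i) r)%:R * f i.
Proof.
move=> uI hI; under [RHS]eq_bigr do rewrite -sum1_count natr_sum mulr_suml
  big_mkcond.
rewrite exchange_big /= big_seq [RHS]big_seq; apply: eq_bigr => k /hI kI.
rewrite (bigD1_seq (src k)) //= eqxx mul1r big1 ?addr0 // => i.
by rewrite eq_sym => /negbTE ->.
Qed.

(** Each [i] is the source of at most [T + 1] steps of the window, or [T] if it precedes [n0]. Half
    of that count is covered, as the assumption makes the constant with [T%:R ^+ 3] at least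
    [T / 2]. *)
Lemma sum_sqr_le_large (R : realFieldType) (T n0 n1 : nat)
    (g s : nat -> R) (la : R)
    (src : nat -> nat) : (forall k, 0 <= s k) ->
  (forall j, src j <= j <= src j + T)%N -> (forall j, s j <= g (src j)) ->
  1 / 2 <= 2 * la ^+ 2 * T%:R * T%:R ->
  \sum_(n0 <= k < n1) s k ^+ 2 / 2 <= \sum_(n0 <= k < n1) g k ^+ 2
    + 2 * la ^+ 2 * T%:R ^+ 3 * \sum_(n0 - 2 * T <= i < n1) g i ^+ 2.
Proof.
move=> s0 srcP s_src cT; pose I := index_iota (n0 - 2 * T) n1.
apply: (@le_trans _ _ (\sum_(n0 <= k < n1) g (src k) ^+ 2 / 2)).
  apply: ler_sum => k _; rewrite ler_wpM2r ?invr_ge0 // ler_sqr ?nnegrE //.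
  exact: le_trans (s_src k).
rewrite (@sum_fiber _ _ I src (fun i => g i ^+ 2 / 2)) ?iota_uniq //;
  last first.
  by move=> k; rewrite !mem_index_iota; have := srcP k; lia.
rewrite (@big_nat_widenl _ _ _ n0 (n0 - 2 * T)%N n1) ?leq_subr // big_mkcond /=.
rewrite mulr_sumr -big_split /= big_seq [leRHS]big_seq; apply: ler_sum => i.
rewrite mem_index_iota => iI; set n := count _ _.
have [nT nT'] : (n <= T.+1)%N /\ ((i < n0)%N -> (n <= T)%N).
  have -> : n = size (seq.filter (fun k => src k == i) (index_iota n0 n1)).
    by rewrite size_filter.
  have sub a : (forall k, (n0 <= k)%N -> src k = i -> (a <= k)%N) ->
    (size [seq k <- index_iota n0 n1 | src k == i] <= (i + T).+1 - a)%N.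
    move=> ha; rewrite -[leqRHS](size_iota a).
    rewrite uniq_leq_size ?filter_uniq ?iota_uniq // => k.
    rewrite mem_filter mem_index_iota mem_iota => /andP[/eqP ki kW].
    by have := srcP k; have := ha k; move: kW ki; lia.
  split=> [|in0].
    apply: leq_trans (sub i _) _; last by lia.
    by move=> k _ <-; case/andP: (srcP k).
  by apply: leq_trans (sub i.+1 _) _; lia.
have c2 : T%:R / 2 <= 2 * la ^+ 2 * T%:R ^+ 3.
  by have := ler_wpM2l (ler0n R T) cT; lra.
have g2 := sqr_ge0 (g i).
have h1 := ler_wpM2r g2 c2.
have [in0|n0i] := ltnP i n0.
  have : n%:R * g i ^+ 2 <= T%:R * g i ^+ 2 by rewrite ler_wpM2r // ler_nat nT'.
  lra.
have : n%:R * g i ^+ 2 <= (T%:R + 1) * g i ^+ 2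
  by rewrite ler_wpM2r // natr1 ler_nat.
lra.
Qed.

Lemma mean_sqr_le (R : realFieldType) (T n0 t : nat) (g s v : nat -> R) (la : R)
    (src : nat -> nat) :
  (forall k, 0 <= g k) -> (forall k, 0 <= s k) -> 0 <= la ->
  (forall j, src j <= j <= src j + T)%N -> (forall j, s j <= g (src j)) ->
  (forall k, (n0 <= k < n0 + t)%N ->
    s k <= g k + la * \sum_(k - T <= j < k) s j + v k) -> (0 < t)%N ->
  (\sum_(n0 <= k < n0 + t) s k) ^+ 2 / (2 * t%:R) <=
    \sum_(n0 <= k < n0 + t) g k ^+ 2 + 2 * \sum_(n0 <= k < n0 + t) v k ^+ 2
    + 2 * la ^+ 2 * T%:R ^+ 3 * \sum_(n0 - 2 * T <= i < n0 + t) g i ^+ 2.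
Proof.
move=> g0 s0 la0 srcP s_src s_step t0.
have tp : 0 < t%:R :> R by rewrite ltr0n.
(* The mean of the [s k] is the maximiser in the Legendre form. *)
set S := \sum_(n0 <= k < n0 + t) s k; pose nu := S / t%:R.
have S0 : 0 <= S by exact: sumr_ge0.
have nu0 : 0 <= nu by rewrite divr_ge0.
have -> : S ^+ 2 / (2 * t%:R) =
    \sum_(n0 <= k < n0 + t) (nu * s k - nu ^+ 2 / 2).
  rewrite big_split /= -mulr_sumr sumr_const_nat addKn -mulr_natl -/S /nu.
  by field; rewrite lt0r_neq0.
have [cT|/ltW cT] := leP (2 * la ^+ 2 * T%:R * T%:R) (1 / 2).
  have := sum_slacks_ge0 g0 s0 la0 nu0 srcP s_src s_step cT.
  by rewrite sum_slacks // subr_ge0.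
apply: (@le_trans _ _ (\sum_(n0 <= k < n0 + t) s k ^+ 2 / 2)).
  apply: ler_sum => k _; have := sqr_ge0 (s k - nu); lra.
apply: (le_trans (sum_sqr_le_large _ _ s0 srcP s_src cT)).
rewrite lerD2r lerDl mulr_ge0 // sumr_ge0 // => k _; exact: sqr_ge0.
Qed.

(** * The Euclidean norm *)

Section Euclidean.
Variables (R : realType) (d : nat).
Implicit Types x y : 'rV[R]_d.

Lemma enorm_ge0 x : 0 <= enorm x.
Proof. exact: sqrtr_ge0. Qed.

Lemma sqr_enorm x : enorm x ^+ 2 = \sum_(i < d) x 0 i ^+ 2.
Proof. by rewrite sqr_sqrtr // sumr_ge0 // => i _; apply: sqr_ge0. Qed.

Lemma enorm0_eq0 x : enorm x = 0 -> x = 0.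
Proof.
move=> x0; apply/rowP => i; rewrite mxE; apply/eqP; rewrite -sqrf_eq0.
have := sqr_enorm x; rewrite x0 expr0n /= => /esym/eqP.
rewrite psumr_eq0 => [/allP/(_ i)|j _]; last exact: sqr_ge0.
by rewrite mem_index_enum => /(_ isT).
Qed.

Lemma dot_le_enorm x y : \sum_(i < d) x 0 i * y 0 i <= enorm x * enorm y.
Proof.
have := enorm_ge0 x; rewrite le0r => /orP[/eqP x0|x0].
  by rewrite x0 mul0r (enorm0_eq0 x0) big1 // => i _; rewrite mxE mul0r.
have := enorm_ge0 y; rewrite le0r => /orP[/eqP y0|y0].
  by rewrite y0 mulr0 (enorm0_eq0 y0) big1 // => i _; rewrite mxE mulr0.
set P := \sum_(i < d) _.
have : 0 <= \sum_(i < d) (enorm y * x 0 i - enorm x * y 0 i) ^+ 2.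
  by rewrite sumr_ge0 // => i _; apply: sqr_ge0.
have -> : \sum_(i < d) (enorm y * x 0 i - enorm x * y 0 i) ^+ 2 =
    2 * (enorm x * enorm y) * (enorm x * enorm y - P).
  transitivity (enorm y ^+ 2 * \sum_(i < d) x 0 i ^+ 2
    + enorm x ^+ 2 * \sum_(i < d) y 0 i ^+ 2 - 2 * (enorm x * enorm y) * P).
    rewrite !mulr_sumr -big_split -sumrB; apply: eq_bigr => i _ /=; ring.
  rewrite -!sqr_enorm; ring.
by rewrite pmulr_rge0 ?subr_ge0 // !mulr_gt0.
Qed.

Lemma enormD x y : enorm (x + y) <= enorm x + enorm y.
Proof.
rewrite -(@ler_pXn2r _ 2%N) ?nnegrE ?addr_ge0 ?enorm_ge0 //.
rewrite sqrrD !sqr_enorm.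
have -> : \sum_(i < d) (x + y) 0 i ^+ 2 = \sum_(i < d) x 0 i ^+ 2
    + (\sum_(i < d) x 0 i * y 0 i) *+ 2 + \sum_(i < d) y 0 i ^+ 2.
  by rewrite -sumrMnl -!big_split; apply: eq_bigr => i _; rewrite mxE sqrrD.
by rewrite lerD2r lerD2l lerMn2r dot_le_enorm orbT.
Qed.

Lemma enormZ (a : R) x : enorm (a *: x) = `|a| * enorm x.
Proof.
rewrite /enorm -sqrtr_sqr -sqrtrM ?sqr_ge0 // mulr_sumr.
by congr Num.sqrt; apply: eq_bigr => i _; rewrite mxE exprMn.
Qed.

Lemma enormN x : enorm (- x) = enorm x.
Proof. by rewrite -scaleN1r enormZ normrN1 mul1r. Qed.

Lemma enorm_sum (I : Type) (r : seq I) (F : I -> 'rV[R]_d) :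
  enorm (\sum_(i <- r) F i) <= \sum_(i <- r) enorm (F i).
Proof.
elim: r => [|i r IH]; last first.
  by rewrite !big_cons (le_trans (enormD _ _)) // lerD2l.
rewrite !big_nil /enorm big1 ?sqrtr0 // => i _; by rewrite mxE expr0n.
Qed.

Lemma sqr_enormD x y : enorm (x + y) ^+ 2 <=
  3 / 2 * enorm x ^+ 2 + 3 * enorm y ^+ 2.
Proof.
rewrite !sqr_enorm !mulr_sumr -big_split; apply: ler_sum => i _; rewrite mxE /=.
have := sqr_ge0 (x 0 i - 2 * y 0 i); lra.
Qed.
End Euclidean.

(** * The recursion along a single sample path *)

Lemma async_sgd_path (R : realType) (d M T n0 t : nat) (eta L : R)
    (x G Z : nat -> 'rV[R]_d) (tau : nat -> 'I_M -> nat) (taumax : nat -> nat) :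
  (0 < M)%N -> 0 < eta -> (0 < t)%N ->
  (forall k m, tau k m <= T)%N -> (forall k m, tau k m <= k)%N ->
  (forall k, x k.+1 = x k - eta *: (\sum_(m < M) G (k - tau k m)%N + Z k)) ->
  (forall a b, enorm (G a - G b) <= L * enorm (x a - x b)) ->
  (forall k, exists2 m, taumax k = tau k m &
     forall m', enorm (x k - x (k - tau k m')%N) <=
       enorm (x k - x (k - tau k m)%N)) ->
  (enorm (x (n0 + t)%N - x n0) ^+ 2
     - 3 * eta ^+ 2 * enorm (\sum_(n0 <= k < n0 + t) Z k) ^+ 2)
    / (3 * eta ^+ 2 * M%:R ^+ 2 * t%:R) <=
  \sum_(n0 <= k < n0 + t) enorm (G k) ^+ 2
  + 2 * L ^+ 2 * eta ^+ 2 * M%:R ^+ 2 * T%:R ^+ 3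
      * \sum_(n0 - 2 * T <= k < n0 + t) enorm (G k) ^+ 2
  + 2 * L ^+ 2 * eta ^+ 2
      * \sum_(n0 <= k < n0 + t) enorm (\sum_(k - taumax k <= j < k) Z j) ^+ 2.
Proof.
move=> M0 eta0 t0 tauT tauk x_step lip tmP.
set C := 2 * L ^+ 2 * eta ^+ 2 * M%:R ^+ 2 * T%:R ^+ 3.
have MR : 0 < M%:R :> R by rewrite ltr0n.
have tR : 0 < t%:R :> R by rewrite ltr0n.
pose S k := \sum_(m < M) G (k - tau k m)%N.
pose s k := enorm (S k) / M%:R; pose g k := enorm (G k).
pose v k := `|L| * eta * enorm (\sum_(k - taumax k <= j < k) Z j).
pose la := `|L| * eta * M%:R.
(* The largest of the [M] delayed gradients dominates their average [s k]; its delay may differ from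
   [taumax k]. *)
pose mx k : 'I_M := [arg max_(m > Ordinal M0) enorm (G (k - tau k m)%N)]%O.
pose src k := (k - tau k (mx k))%N.
have sM k : enorm (S k) = M%:R * s k
  by rewrite /s mulrCA divff ?mulr1 ?lt0r_neq0.
have s0 k : 0 <= s k by rewrite divr_ge0 ?enorm_ge0.
have path a b : (a <= b)%N ->
    x b - x a = - (eta *: (\sum_(a <= j < b) S j + \sum_(a <= j < b) Z j)).
  move=> ab; rewrite -(telescope_sumr _ ab) -big_split scaler_sumr -sumrN.
  by apply: eq_bigr => j _; rewrite x_step addrC addKr.
have srcP j : (src j <= j <= src j + T)%N.
  by rewrite /src; have := tauT j (mx j); lia.
have s_src k : s k <= g (src k).
  rewrite ler_pdivrMr // (le_trans (enorm_sum _ _)) //.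
  apply: (@le_trans _ _ (\sum_(m < M) g (src k))); last first.
    by rewrite sumr_const card_ord mulr_natr.
  apply: ler_sum => m _; rewrite /src /mx /g.
  by case: arg_maxP => // m1 _; apply.
have s_step k : s k <= g k + la * \sum_(k - T <= j < k) s j + v k.
  (* The displacement [Dl] bounds all [M] displacements, so the noise enters only through its sum
     over the last [taumax k] steps. *)
  have [m tm hm] := tmP k; set Dl := enorm (x k - _) in hm.
  have hD : `|L| * Dl <= la * \sum_(k - T <= j < k) s j + v k.
    rewrite /la /v -!mulrA -mulrDr ler_wpM2l // -mulrDr.
    rewrite /Dl path ?leq_subr // enormN enormZ gtr0_norm // ler_pM2l //.
    rewrite (le_trans (enormD _ _)) // tm lerD2r (le_trans (enorm_sum _ _)) //.
    rewrite mulr_sumr (@big_cat_nat _ _ _ (k - tau k m) (k - T)) //=;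
      last 2 first.
    - by have := tauT k m; lia.
    - exact: leq_subr.
    apply: ler_wpDl; first by rewrite sumr_ge0 // => j _; rewrite mulr_ge0.
    by apply: ler_sum => j _; rewrite sM.
  suff : enorm (S k) <= M%:R * (g k + `|L| * Dl).
    by rewrite sM ler_pM2l // => /le_trans; apply; rewrite -addrA lerD2l.
  have -> : S k = M%:R *: G k + \sum_(m < M) (G (k - tau k m)%N - G k).
    by rewrite big_split /= sumr_const card_ord mulNrn -[G k *+ M]scaler_nat
      addrCA subrr addr0.
  rewrite (le_trans (enormD _ _)) // enormZ gtr0_norm // mulrDr lerD2l.
  rewrite (le_trans (enorm_sum _ _)) //.
  apply: (@le_trans _ _ (\sum_(m < M) `|L| * Dl)); last first.
    by rewrite sumr_const card_ord mulr_natl.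
  apply: ler_sum => m' _; rewrite (le_trans (lip _ _)) //.
  apply: (@le_trans _ _ (`|L| * enorm (x (k - tau k m')%N - x k))).
    by rewrite ler_wpM2r ?enorm_ge0 // ler_norm.
  by rewrite ler_wpM2l // -enormN opprB.
have la0 : 0 <= la by rewrite !mulr_ge0 // ltW.
have key := mean_sqr_le (fun k => enorm_ge0 (G k)) s0 la0 srcP s_src
  (fun k (_ : (n0 <= k < n0 + t)%N) => s_step k) t0.
set Sm := \sum_(n0 <= k < n0 + t) s k in key.
have L2 : `|L| ^+ 2 = L ^+ 2 by rewrite real_normK ?num_real.
have C2 : 2 * la ^+ 2 * T%:R ^+ 3 = C by rewrite /la !exprMn L2 /C; ring.
have V2 : 2 * \sum_(n0 <= k < n0 + t) v k ^+ 2 = 2 * L ^+ 2 * eta ^+ 2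
      * \sum_(n0 <= k < n0 + t) enorm (\sum_(k - taumax k <= j < k) Z j) ^+ 2.
  rewrite !mulr_sumr; apply: eq_bigr => k _; rewrite /v !exprMn L2; ring.
rewrite C2 V2 in key.
set N := \sum_(n0 <= k < n0 + t) Z k.
have hD : enorm (x (n0 + t)%N - x n0) ^+ 2 <=
    eta ^+ 2 * (3 / 2 * (M%:R * Sm) ^+ 2 + 3 * enorm N ^+ 2).
  rewrite path ?leq_addr // enormN enormZ exprMn gtr0_norm //.
  rewrite ler_wpM2l ?sqr_ge0 // (le_trans (sqr_enormD _ _)) // lerD2r.
  rewrite ler_wpM2l ?divr_ge0 // ler_sqr ?nnegrE ?enorm_ge0 //; last first.
    by rewrite mulr_ge0 // sumr_ge0.
  rewrite (le_trans (enorm_sum _ _)) // mulr_sumr; apply: ler_sum => j _.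
  by rewrite sM.
apply: (@le_trans _ _ (Sm ^+ 2 / (2 * t%:R)));
  last by move: key; rewrite addrAC.
rewrite ler_pdivrMr ?mulr_gt0 ?exprn_gt0 //.
have -> : Sm ^+ 2 / (2 * t%:R) * (3 * eta ^+ 2 * M%:R ^+ 2 * t%:R) =
  eta ^+ 2 * (3 / 2 * (M%:R * Sm) ^+ 2) by field; rewrite lt0r_neq0.
lra.
Qed.

(* Integer-indexed sums from t0 - 2T: truncated subtraction drops exactly the
   terms with negative index. *)
Theorem lemma6 (R : realType) (d n M T : nat)
  (d_gt0 : (0 < d)%N) (n_gt0 : (0 < n)%N) (M_gt0 : (0 < M)%N)
  (L rho s l eta r : R) (s_gt0 : 0 < s) (eta_gt0 : 0 < eta)
  (fs : 'I_n -> 'rV[R]_d -> R^o) (f : 'rV[R]_d -> R^o)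
  (fs_smooth : forall i, smooth (fs i))
  (f_mean : f = mean_fun fs)
  (f_smooth : L_smooth L f)
  (f_hess : hessian_Lipschitz rho f)
  (dT dO : measure_display)
  (Theta : measurableType dT) (D : probability Theta R)
  (Omega : measurableType dO) (P : probability Omega R)
  (g : 'rV[R]_d -> Theta -> 'rV[R]_d)
  (g_sg : stochastic_gradient D f s l g)
  (theta : nat -> 'I_M -> {RV P >-> Theta})
  (zeta : nat -> Omega -> 'rV[R]_d)
  (tau : nat -> 'I_M -> {RV P >-> nat})
  (x : nat -> Omega -> 'rV[R]_d)
  (x_sgd : async_sgd D T eta r g theta zeta tau x)
  (noise : nat -> 'I_M -> Omega -> 'rV[R]_d)
  (noise_total : total_noise_decomposition f g theta zeta tau x noise)
  (taumax : nat -> {RV P >-> nat})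
  (taumaxP : maximal_delay tau x taumax)
  (eta_cond : eta ^+ 2 * (3 * L / 4 - L ^+ 2 * M%:R * T%:R ^+ 2 * eta)
              - eta / (2 * M%:R) < 0) :
  forall (t0 t : nat), (1 <= t)%N -> forall w : Omega,
  \sum_(t0 <= k < t0 + t)
     (1 + 2 * L ^+ 2 * eta ^+ 2 * M%:R ^+ 2 * T%:R ^+ 3)
       * enorm (grad f (x k w)) ^+ 2
  >= (enorm (x (t0 + t)%N w - x t0 w) ^+ 2
      - 3 * eta ^+ 2
        * enorm (\sum_(m < M) \sum_(t0 <= i < t0 + t) noise i m w) ^+ 2)
     / (3 * eta ^+ 2 * M%:R ^+ 2 * t%:R)
   - \sum_(t0 - 2 * T <= k < t0)
       2 * L ^+ 2 * M%:R ^+ 2 * eta ^+ 2 * T%:R ^+ 3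
         * enorm (grad f (x k w)) ^+ 2
   - \sum_(t0 <= k < t0 + t)
       2 * L ^+ 2 * eta ^+ 2
         * enorm (\sum_(k - taumax k w <= j < k) \sum_(m < M) noise j m w) ^+ 2.
Proof.
move=> t0 t t1 w.
have tauT k m := sgd_delay x_sgd k m w.
have tauk k m := sgd_delay_nonneg x_sgd k m w.
(* By the prescribed total noise, the stochastic gradients become exact delayed gradients plus
   noise. *)
have x_step k : x k.+1 w = x k w - eta *:
    (\sum_(m < M) grad f (x (k - tau k m w)%N w) + \sum_(m < M) noise k m w).
  rewrite noise_total sumrB addrA [\sum_(m < M) _ + _]addrC subrK.
  exact: sgd_step x_sgd k w.
have lip a b : enorm (grad f (x a w) - grad f (x b w)) <=
  L * enorm (x a w - x b w).
  by case: f_smooth.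
have key := async_sgd_path t0 M_gt0 eta_gt0 t1 tauT tauk x_step lip
  (taumaxP^~ w).
have -> : \sum_(m < M) \sum_(t0 <= i < t0 + t) noise i m w =
    \sum_(t0 <= i < t0 + t) \sum_(m < M) noise i m w by rewrite exchange_big.
rewrite -!mulr_sumr lerBlDr lerBlDr.
have e : (t0 - 2 * T <= t0 <= t0 + t)%N by rewrite leq_subr leq_addr.
case/andP: e => e1 e2.
(* Split at [t0]: the part in the window joins the factor 1 on the left of the claim, the earlier
   part is the subtracted history. *)
rewrite (big_cat_nat e1 e2) /= in key.
apply: (le_trans key).
rewrite le_eqVlt; apply/orP; left; apply/eqP; ring.
Qed.
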